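(* There exist functions $a,b\in L^{\infty}(D^2)\cap H^{1}(D^2)$ such that the solution $\varphi$ with zero mean value on $D^2$ of the Neumann problem $$\begin{cases}-\Delta \varphi=\nabla a\cdot\nabla^{\perp}b & \text{in } D^2,\\ \partial_{\nu}\varphi=0 & \text{on } \partial D^2,\end{cases}$$ is not in $H^{1}(D^2)$.
   Context: $D^2=\{(x,y)\in\mathbb{R}^2: x^2+y^2<1\}$ is the open unit disk, $\nu$ is the outward unit normal to $\partial D^2$, and functions are real-valued. For $b$ on $D^2$, $\nabla^{\perp}b=(\partial_{x_2}b,-\partial_{x_1}b)$, so that $\nabla a\cdot\nabla^{\perp}b=\partial_{x_1}a\,\partial_{x_2}b-\partial_{x_2}a\,\partial_{x_1}b\in L^1(D^2)$ for $a,b\in H^1(D^2)$. $H^1=W^{1,2}$. The solution is understood in the weak sense: $\varphi\in W^{1,1}(D^2)$ with $\int_{D^2}\varphi\,dx=0$ and $$\int_{D^2}\nabla\varphi\cdot\nabla v\,dx=\int_{D^2}(\nabla a\cdot\nabla^{\perp}b)\,v\,dx\qquad\text{for all } v\in C^{\infty}(\overline{D^2}).$$ The claim includes that such a solution exists for the given $a,b$ (in particular $\int_{D^2}\nabla a\cdot\nabla^\perp b\,dx=0$). *)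

(* Defs.v *)
From HB Require Import structures.
From mathcomp Require Import all_boot all_order all_algebra.
From mathcomp Require Import all_classical all_reals all_analysis.

Set Implicit Arguments.
Unset Strict Implicit.
Unset Printing Implicit Defensive.
Import Order.TTheory GRing.Theory Num.Theory.
Import numFieldNormedType.Exports.
Local Open Scope classical_set_scope.
Local Open Scope ring_scope.

Section Sobolev.
Context {R : realType}.
Implicit Types (Omega : set (R * R)) (p : \bar R).

Definition lebesgue2 :=
  ((@lebesgue_measure R) \x (@lebesgue_measure R))%E.

(* A function on Omega is represented by a (Borel) function on the plane, of
   which only the values on Omega matter: it is in L^p(Omega) when its extension
   by zero is in L^p of the plane. *)
Definition Lp Omega p (u : R * R -> R) : Prop :=
  (u \_ Omega) \in Lfun lebesgue2 p.

Definition dir (i : bool) : R * R := if i then (0, 1) else (1, 0).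

Definition partial (i : bool) (f : R * R -> R) : R * R -> R :=
  fun x => 'D_(dir i) f x.

Definition grad (f : R * R -> R) (x : R * R) : R * R :=
  (partial false f x, partial true f x).

Definition dot (u v : R * R) : R := u.1 * v.1 + u.2 * v.2.

(* perp maps the gradient of b to its perpendicular gradient (d2 b, - d1 b). *)
Definition perp (u : R * R) : R * R := (u.2, - u.1).

(* The derivative 'D_v f x is a total operator (a junk value if f is not
   derivable), hence the explicit derivability clause. *)
Definition smooth (f : R * R -> R) : Prop :=
  forall s : seq bool, let h := foldr partial f s in
    continuous h /\ forall x i, derivable h x (dir i).

Definition test_function Omega (f : R * R -> R) : Prop :=
  let supp := closure [set x | f x != 0] in
  [/\ smooth f, compact supp & supp `<=` Omega].

Definition weak_partial Omega (i : bool) (u g : R * R -> R) : Prop :=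
  forall f, test_function Omega f ->
    \int[lebesgue2]_(x in Omega) (u x * partial i f x) =
    - \int[lebesgue2]_(x in Omega) (g x * f x).

(* u is in W^{1,p}(Omega), with weak gradient g. *)
Definition sobolev_grad Omega p (u : R * R -> R) (g : R * R -> R * R) : Prop :=
  [/\ Lp Omega p u,
      Lp Omega p (fun x => (g x).1), Lp Omega p (fun x => (g x).2),
      weak_partial Omega false u (fun x => (g x).1)
    & weak_partial Omega true u (fun x => (g x).2)].

Definition sobolev Omega p (u : R * R -> R) : Prop :=
  exists g, sobolev_grad Omega p u g.

Definition disk : set (R * R) := [set x | x.1 ^+ 2 + x.2 ^+ 2 < 1].

(* Zero-mean weak solution in W^{1,1} of - Laplacian phi = f in the disk with
   zero normal derivative on the boundary. The test functions, smooth up to the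
   boundary, are the restrictions to the closed disk of smooth functions v on the
   plane; the integrals over the open disk only depend on that restriction. *)
Definition neumann_solution (f phi : R * R -> R) : Prop :=
  exists g, [/\ sobolev_grad disk 1%:E phi g,
    \int[lebesgue2]_(x in disk) phi x = 0
  & forall v, smooth v ->
    \int[lebesgue2]_(x in disk) dot (g x) (grad v x) =
    \int[lebesgue2]_(x in disk) (f x * v x)].

End Sobolev.

Arguments disk R : clear implicits.

(* Main.v *)
From HB Require Import structures.
Require Import Defs.
From mathcomp Require Import all_boot all_order all_algebra.
From mathcomp Require Import all_classical all_reals all_analysis.
From mathcomp Require Import measurable_realfun ess_sup_inf.
From mathcomp Require Import ring lra.

(** The map log((1+z)/(1-z)) sends the disk conformally onto the strip with
    coordinates t in R, |theta| < pi/2, in which the Dirichlet energy, the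
    Jacobian and the Neumann condition keep their form.  There a function
    phi(t) satisfies the Neumann condition, and it fails to be in H^1 as soon as
    phi' is not square integrable on R.  In polar form
    a = rho sin psi, b = rho cos psi the Jacobian of (a, b) is that of
    (psi, rho^2/2); with rho^2 = (pi + theta) (1+t^2)^(-5/8) and psi(t) growing
    like |t| it is a function of t alone, and a, b are bounded with square
    integrable gradients because 5/4 > 1.  This function is - phi'' with
    phi' ~ |t|^(-1/4), so the limits of phi' at the two boundary singularities
    vanish and phi is a weak solution; but the right-hand side tested against
    regularizations of (log(1/|1-z|))^(1/4), which are bounded in H^1, blows up,
    so that no solution is in H^1. *)

Set Implicit Arguments.
Unset Strict Implicit.
Unset Printing Implicit Defensive.
Import Order.TTheory GRing.Theory Num.Theory.
Import numFieldNormedType.Exports.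
Local Open Scope classical_set_scope.
Local Open Scope ring_scope.

(** * Functions smooth on an open set of the plane *)

Section Derive.
Context {R : realType} {V : normedModType R}.

(** The exponents come from a one-dimensional count on the strip. If rho^2 decays like |t|^(-p)
    while |psi'| stays of order 1, the energies of a and b behave like the integral of |t|^(-p),
    finite for p > 1, and phi' ~ |t|^(1-p) fails to be square integrable for p <= 3/2; p = 5/4 is
    the middle of this window. A test function growing like |t|^q has finite energy for q < 1/2, and
    its pairing with the right-hand side diverges as soon as q >= p - 1. The choice q = 1/4 is the
    borderline: the divergence is only doubly logarithmic in the distance to the singularity, but
    the integrals are explicit. The blow-up contradicts an energy bound valid for every solution;
    there the W^{1,1} gradient of the solution must first be identified with its L^2 gradient,
    tested on functions smooth up to the circle. The obstacle to existence is the passage from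
    compactly supported tests to such functions: an ordinary cut-off leaves a term whose natural
    majorant is |t|^(-1/4) on the strip, not integrable, and a logarithmic one gains the missing
    factor 1/|t|. *)

Lemma scaler1R (h : R) : h *: (1 : R) = h.
Proof. exact: mulr1. Qed.

(** Turns a directional derivative into a derivative along a line, so that the one-variable chain
    rule gives [is_derive_comp] in every direction. *)
Lemma is_derive_line (f : V -> R) (z d : V) (df : R) :
  is_derive z d f df <-> is_derive (0 : R) 1 (fun s : R => f (z + s *: d)) df.
Proof.
have E : (fun h : R => h^-1 *: ((f \o shift z) (h *: d) - f z)) =
  (fun h : R => h^-1 *: (((fun s : R => f (z + s *: d)) \o shift 0) (h *: 1)
     - (fun s : R => f (z + s *: d)) 0)).
  apply/funext => h /=.
  by rewrite scale0r !addr0 scaler1R [z + _]addrC.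
split=> -[D1 D2]; split; move: D1 D2; rewrite /derivable /derive E //.
Qed.

Lemma is_derive_comp (F : R -> R) (f : V -> R) (z d : V) (df dF : R) :
  is_derive (f z) 1 F dF -> is_derive z d f df ->
  is_derive z d (fun z => F (f z)) (dF * df).
Proof.
move=> HF /is_derive_line Hf; apply/is_derive_line.
apply: (@is_derive1_comp _ F (fun s : R => f (z + s *: d)) 0) => //.
by rewrite scale0r addr0.
Qed.

Lemma is_derive_val (f : V -> R) (z d : V) (a b : R) :
  is_derive z d f a -> a = b -> is_derive z d f b.
Proof. by move=> ? <-. Qed.

Lemma is_derive_add (f g : V -> R) (z d : V) (a b : R) :
  is_derive z d f a -> is_derive z d g b ->
  is_derive z d (fun z => f z + g z) (a + b).
Proof. exact: is_deriveD. Qed.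

Lemma is_derive_opp (f : V -> R) (z d : V) (a : R) :
  is_derive z d f a -> is_derive z d (fun z => - f z) (- a).
Proof. exact: is_deriveN. Qed.

Lemma is_derive_mul (f g : V -> R) (z d : V) (a b : R) :
  is_derive z d f a -> is_derive z d g b ->
  is_derive z d (fun z => f z * g z) (f z * b + g z * a).
Proof. exact: is_deriveM. Qed.

Lemma is_derive_inv (f : V -> R) (z d : V) (a : R) : f z != 0 ->
  is_derive z d f a -> is_derive z d (fun z => (f z)^-1) (- (f z) ^- 2 * a).
Proof.
move=> fz0 Df; apply: is_derive_comp Df.
have := @is_deriveV _ id (f z) 1 1 fz0 (is_derive_id _ _).
by rewrite scaler1R.
Qed.

Lemma is_derive_exp k (f : V -> R) (z d : V) (a : R) :
  is_derive z d f a -> is_derive z d (fun z => f z ^+ k) (k%:R * f z ^+ k.-1 * a).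
Proof.
move=> Df; apply: (@is_derive_comp (fun u : R => u ^+ k)).
have := @is_deriveX R R id k (f z) 1 1 (is_derive_id _ _).
by rewrite scaler1R exprfctE.
Qed.

End Derive.

Section Plane.
Context {R : realType}.
Implicit Types (Om : set (R * R)) (f g h u v : R * R -> R) (z : R * R) (i : bool).

Lemma is_derive_fst z i : is_derive z (dir i) (@fst R R) (~~ i)%:R.
Proof.
apply/is_derive_line.
rewrite (_ : (fun s : R => _) = fun s => z.1 + s * (~~ i)%:R); last first.
  by apply/funext => s; case: i.
apply: is_derive_val (is_derive_add (is_derive_cst _ _ _)
  (is_derive_mul (is_derive_id _ _) (is_derive_cst _ _ _))) _.
by rewrite add0r mulr0 add0r mulr1.
Qed.

Lemma is_derive_snd z i : is_derive z (dir i) (@snd R R) i%:R.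
Proof.
apply/is_derive_line.
rewrite (_ : (fun s : R => _) = fun s => z.2 + s * i%:R); last first.
  by apply/funext => s; case: i.
apply: is_derive_val (is_derive_add (is_derive_cst _ _ _)
  (is_derive_mul (is_derive_id _ _) (is_derive_cst _ _ _))) _.
by rewrite add0r mulr0 add0r mulr1.
Qed.

Lemma is_derive_slice1 f (x y df : R) :
  is_derive (x, y) (dir false) f df -> is_derive x 1 (fun s => f (s, y)) df.
Proof.
have E : (fun h : R => h^-1 *: ((f \o shift (x, y)) (h *: (dir false)) - f (x, y))) =
  (fun h : R => h^-1 *: (((fun s : R => f (s, y)) \o shift x) (h *: 1) - f (x, y))).
  apply/funext => h /=; congr (_ *: (f _ - _)).
  by congr (_, _) => /=; rewrite scaler0 add0r.
by move=> -[D1 D2]; split; move: D1 D2; rewrite /derivable /derive E.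
Qed.

Lemma is_derive_slice2 f (x y df : R) :
  is_derive (x, y) (dir true) f df -> is_derive y 1 (fun s => f (x, s)) df.
Proof.
have E : (fun h : R => h^-1 *: ((f \o shift (x, y)) (h *: (dir true)) - f (x, y))) =
  (fun h : R => h^-1 *: (((fun s : R => f (x, s)) \o shift y) (h *: 1) - f (x, y))).
  apply/funext => h /=; congr (_ *: (f _ - _)).
  by congr (_, _) => /=; rewrite scaler0 add0r.
by move=> -[D1 D2]; split; move: D1 D2; rewrite /derivable /derive E.
Qed.

Lemma is_derive1_continuous (F : R -> R) (x dF : R) :
  is_derive x 1 F dF -> {for x, continuous F}.
Proof.
by move=> -[dF' _]; apply/differentiable_continuous/derivable1_diffP.
Qed.

(** The classical flat function exp(-1/s) together with its multiples by s^(-k): the span of the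
    family is stable under differentiation, so that one indexed constructor of [smooth_on] is enough
    to provide cut-offs. *)
Definition flat (k : nat) (s : R) : R :=
  if 0 < s then s^-1 ^+ k * expR (- s^-1) else 0.

Lemma flat_ge0 k (s : R) : 0 <= flat k s.
Proof.
rewrite /flat; case: ifP => // s0.
by rewrite mulr_ge0 ?expR_ge0 // exprn_ge0 // invr_ge0 ltW.
Qed.

Lemma flat_le0 k (s : R) : s <= 0 -> flat k s = 0.
Proof. by rewrite /flat ltNge => ->. Qed.

Lemma flat_le k (s : R) : 0 < s -> flat k s <= (k.+1%:R ^+ k.+1) * s.
Proof.
move=> s0; rewrite /flat s0.
have m0 : 0 < k.+1%:R :> R by rewrite ltr0n.
(* From exp x >= (x/m)^m with x = 1/s and m = k+1; this is one power of 1/s more than [flat k]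
   contains, which leaves the factor s. *)
have E : (s^-1 / k.+1%:R) ^+ k.+1 <= expR s^-1.
  have -> : s^-1 = k.+1%:R * (s^-1 / k.+1%:R) by field; rewrite !gt_eqF // -?natr1.
  rewrite expRM_natl.
  have -> : k.+1%:R * (s^-1 / k.+1%:R) / k.+1%:R = s^-1 / k.+1%:R.
    by field; rewrite !gt_eqF.
  rewrite lerXn2r ?nnegrE ?expR_ge0 ?divr_ge0 ?invr_ge0 ?(ltW s0) ?(ltW m0) //.
  by apply: le_trans (expR_ge1Dx _); rewrite lerDr.
rewrite expRN ler_pdivrMr ?expR_gt0 //.
apply: le_trans (ler_wpM2l _ E); last by rewrite mulr_ge0 ?(ltW s0) ?exprn_ge0 ?ltW.
rewrite expr_div_n [s^-1 ^+ k.+1]exprS [k.+1%:R ^+ k.+1]exprS.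
set K := k.+1%:R ^+ k; set P := s^-1 ^+ k.
have K0 : K != 0 by rewrite expf_neq0 // pnatr_eq0.
rewrite le_eqVlt; apply/orP; left; apply/eqP; field.
by rewrite K0 (gt_eqF s0) nat1r pnatr_eq0.
Qed.

Lemma flat_is_derive k (s : R) :
  is_derive (s : R) (1 : R) (flat k) (flat k.+2 s - k%:R * flat k.+1 s).
Proof.
have [s0|s0|->] := ltgtP s 0.
- apply: (@near_eq_is_derive _ _ _ (cst 0)).
    by near=> u; rewrite flat_le0 //; near: u; exact: lt_le_nbhsl.
  by rewrite !flat_le0 ?(ltW s0) // mulr0 subr0; exact: is_derive_cst.
- apply: (@near_eq_is_derive R R R (fun u : R => u^-1 ^+ k * expR (- u^-1))).
    by near=> u; rewrite /flat ifT //; near: u; exact: lt_nbhsr.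
  have sn0 : s != 0 by rewrite gt_eqF.
  have D1 := is_derive_inv sn0 (is_derive_id s (1 : R)).
  have D2 := is_derive_comp (is_derive_expR _) (is_derive_opp D1).
  apply: is_derive_val (is_derive_mul (is_derive_exp k D1) D2) _.
  rewrite /flat s0 /= !mulr1 -exprVn.
  case: (k) => [|m] /=; first by rewrite expr0; ring.
  by rewrite !exprS; ring.
- rewrite !(@flat_le0 _ 0) // mulr0 subr0.
  suff L : (fun h : R => h^-1 *: ((flat k \o shift 0) (h *: 1) - flat k 0)) @ 0^' --> (0:R).
    split; first by apply/cvg_ex; exists 0.
    exact/cvg_lim.
  (* The difference quotient of [flat k] at 0 is [flat k.+1] itself, which [flat_le] squeezes to
     0. *)
  rewrite (_ : (fun h : R => _) = flat k.+1); last first.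
    apply/funext => h /=; rewrite addr0 [_ *: 1]mulr1 (@flat_le0 _ 0) // subr0.
    by rewrite /flat /GRing.scale /=; case: ifP => // _; rewrite ?mulr0 // exprS mulrA.
  apply: cvg_within_filter.
  apply: (@squeeze_cvgr _ _ _ _ (cst 0) (fun u : R => k.+2%:R ^+ k.+2 * `|u|)).
  + near=> u; rewrite flat_ge0 /=.
    have [u0|u0] := ltP 0 u; first by rewrite gtr0_norm // flat_le.
    by rewrite flat_le0 // mulr_ge0 // exprn_ge0.
  + exact: cvg_cst.
  + rewrite -[X in _ --> X](mulr0 (k.+2%:R ^+ k.+2)); apply: cvgM; first exact: cvg_cst.
    by rewrite -[X in _ --> X](@normr0 _ R); exact: cvg_norm.
Unshelve. all: by end_near.
Qed.

(* Closed under partial derivatives on Om: this reduces the smoothness of explicit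
   functions, and of their products with arbitrary smooth ones, to syntax. *)
Inductive smooth_on Om : (R * R -> R) -> Prop :=
| sm_smooth v : smooth v -> smooth_on Om v
| sm_cst c : smooth_on Om (fun=> c)
| sm_fst : smooth_on Om fst
| sm_snd : smooth_on Om snd
| sm_add f g : smooth_on Om f -> smooth_on Om g -> smooth_on Om (fun z => f z + g z)
| sm_mul f g : smooth_on Om f -> smooth_on Om g -> smooth_on Om (fun z => f z * g z)
| sm_inv f : (forall z, Om z -> f z != 0) -> smooth_on Om f -> smooth_on Om (fun z => (f z)^-1)
| sm_ln f : (forall z, Om z -> 0 < f z) -> smooth_on Om f -> smooth_on Om (fun z => ln (f z))
| sm_exp f : smooth_on Om f -> smooth_on Om (fun z => expR (f z))
| sm_cos f : smooth_on Om f -> smooth_on Om (fun z => cos (f z))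
| sm_sin f : smooth_on Om f -> smooth_on Om (fun z => sin (f z))
| sm_atan f : smooth_on Om f -> smooth_on Om (fun z => atan (f z))
| sm_flat k f : smooth_on Om f -> smooth_on Om (fun z => flat k (f z)).

Lemma sm_opp Om f : smooth_on Om f -> smooth_on Om (fun z => - f z).
Proof.
move=> sf; rewrite (_ : (fun z => _) = fun z => -1 * f z).
  by apply: sm_mul => //; exact: sm_cst.
by apply/funext => z; rewrite mulN1r.
Qed.

Lemma sm_sub Om f g : smooth_on Om f -> smooth_on Om g -> smooth_on Om (fun z => f z - g z).
Proof. by move=> sf sg; apply: sm_add => //; exact: sm_opp. Qed.

Lemma sm_pow Om n f : smooth_on Om f -> smooth_on Om (fun z => f z ^+ n).
Proof.
move=> sf; elim: n => [|n IH]; first exact: sm_cst.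
rewrite (_ : (fun z => _) = fun z => f z * f z ^+ n); first exact: sm_mul.
by apply/funext => z; rewrite exprS.
Qed.

Lemma sm_continuous Om f z : smooth_on Om f -> Om z -> {for z, continuous f}.
Proof.
move=> sf Oz; elim: sf => {f}.
- by move=> v /(_ [::]) [cv _]; exact: cv.
- by move=> c; exact: cst_continuous.
- exact: cvg_fst.
- exact: cvg_snd.
- by move=> f g _ IHf _ IHg; apply: cvgD.
- by move=> f g _ IHf _ IHg; apply: cvgM.
- by move=> f f0 _ IHf; apply: cvgV => //; exact: f0.
- move=> f f0 _ IHf; apply: (continuous_comp IHf).
  by apply: continuous_ln; exact: f0.
- by move=> f _ IHf; apply: (continuous_comp IHf); exact: continuous_expR.
- by move=> f _ IHf; apply: (continuous_comp IHf); exact: continuous_cos.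
- by move=> f _ IHf; apply: (continuous_comp IHf); exact: continuous_sin.
- by move=> f _ IHf; apply: (continuous_comp IHf); exact: continuous_atan.
- move=> k f _ IHf; apply: (continuous_comp IHf).
  exact: is_derive1_continuous (flat_is_derive _ _).
Qed.

Lemma sm_partial Om f i : smooth_on Om f ->
  exists2 g, smooth_on Om g & forall z, Om z -> is_derive z (dir i) f (g z).
Proof.
elim=> {f}.
- move=> v sv; exists (partial i v).
    by apply: sm_smooth => s; have := sv (rcons s i); rewrite foldr_rcons.
  move=> z _; apply: derivableP; have := sv [::] => -[_ dv]; exact: dv.
- by move=> c; exists (fun=> 0); [exact: sm_cst|move=> z _; exact: is_derive_cst].
- by exists (fun=> (~~ i)%:R); [exact: sm_cst|move=> z _; exact: is_derive_fst].
- by exists (fun=> i%:R); [exact: sm_cst|move=> z _; exact: is_derive_snd].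
- move=> f g _ [f' sf' df] _ [g' sg' dg]; exists (fun z => f' z + g' z).
    exact: sm_add.
  by move=> z Oz; apply: is_derive_add; [exact: df|exact: dg].
- move=> f g sf [f' sf' df] sg [g' sg' dg]; exists (fun z => f z * g' z + g z * f' z).
    by apply: sm_add; exact: sm_mul.
  by move=> z Oz; apply: is_derive_mul; [exact: df|exact: dg].
- move=> f f0 sf [f' sf' df]; exists (fun z => (- (f z ^+ 2)^-1) * f' z).
    apply: sm_mul => //; apply: sm_opp; apply: sm_inv; last exact: sm_pow.
    by move=> z Oz; rewrite expf_neq0 // f0.
  by move=> z Oz; apply: is_derive_inv; [exact: f0|exact: df].
- move=> f f0 sf [f' sf' df]; exists (fun z => (f z)^-1 * f' z).
    apply: sm_mul => //; apply: sm_inv => // z Oz.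
    by rewrite gt_eqF // f0.
  move=> z Oz; apply: is_derive_comp; last exact: df.
  exact/is_derive1_ln/f0.
- move=> f sf [f' sf' df]; exists (fun z => expR (f z) * f' z).
    by apply: sm_mul => //; exact: sm_exp.
  by move=> z Oz; apply: is_derive_comp; exact: df.
- move=> f sf [f' sf' df]; exists (fun z => (- sin (f z)) * f' z).
    by apply: sm_mul => //; apply/sm_opp/sm_sin.
  by move=> z Oz; apply: is_derive_comp; exact: df.
- move=> f sf [f' sf' df]; exists (fun z => cos (f z) * f' z).
    by apply: sm_mul => //; apply/sm_cos.
  by move=> z Oz; apply: is_derive_comp; exact: df.
- move=> f sf [f' sf' df]; exists (fun z => (1 + f z ^+ 2)^-1 * f' z).
    apply: sm_mul => //; apply: sm_inv.
      by move=> z _; rewrite gt_eqF // ltr_pwDl // sqr_ge0.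
    by apply: sm_add; [exact: sm_cst|exact: sm_pow].
  by move=> z Oz; apply: is_derive_comp; exact: df.
- move=> k f sf [f' sf' df].
  exists (fun z => (flat k.+2 (f z) - k%:R * flat k.+1 (f z)) * f' z).
    apply: sm_mul => //; apply: sm_sub; first exact: sm_flat.
    by apply: sm_mul; [exact: sm_cst|exact: sm_flat].
  by move=> z Oz; apply: is_derive_comp; [exact: flat_is_derive|exact: df].
Qed.

Lemma sm_smoothT f : smooth_on setT f -> smooth f.
Proof.
move=> sf s; have {sf} : smooth_on setT (foldr partial f s).
  elim: s => //= i s IH; have [g sg dg] := sm_partial i IH.
  rewrite (_ : partial _ _ = g) //; apply/funext => z.
  by have [] := dg z I.
move=> sh h; split; first by move=> z; exact: (sm_continuous sh).
move=> z i; have [g _ dg] := sm_partial i sh.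
by have [] := dg z I.
Qed.

End Plane.

(** * Test functions and integration by parts on the disk *)

Section Integral.
Context {R : realType}.
Local Notation Rm := (measurableTypeR R).
Local Notation R2 := (measurableTypeR R * measurableTypeR R)%type.
Implicit Types (Om : set (R * R)) (f g h u v : R * R -> R) (z : R * R) (i : bool).

Lemma FTC2 (F f : R -> R) (a b : R) : a < b ->
  (forall x, a <= x <= b -> is_derive x 1 F (f x)) ->
  (forall x, a <= x <= b -> {for x, continuous f}) ->
  (\int[lebesgue_measure]_(x in `[a, b]) (f x)%:E = (F b - F a)%:E)%E.
Proof.
move=> ab dF cf; rewrite EFinB; apply: continuous_FTC2 => //.
- apply: continuous_in_subspaceT => x /[!inE] /=; rewrite in_itv /=; exact: cf.
- split.
  + move=> x /[!in_itv] /= /andP[ax xb].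
    by have [] := dF x (introT andP (conj (ltW ax) (ltW xb))).
  + apply: cvg_at_right_filter; apply: is_derive1_continuous; apply: dF.
    by rewrite lexx ltW.
  + apply: cvg_at_left_filter; apply: is_derive1_continuous; apply: dF.
    by rewrite lexx ltW.
- move=> x /[!in_itv] /= /andP[ax xb].
  rewrite derive1E; have [] := dF x (introT andP (conj (ltW ax) (ltW xb))) => //.
Qed.

(** The sigma-algebra of the plane is here the product one, so an open set is recovered as the
    countable union of the boxes with rational centres and sides 2/(n+1) that it contains. *)
Lemma open_measurable2 (U : set (R * R)) : open U -> measurable (U : set R2).
Proof.
move=> oU.
pose box (p : rat * rat * nat) := ball (ratr p.1.1 : R) (p.2.+1%:R^-1 : R) `*`
  ball (ratr p.1.2 : R) (p.2.+1%:R^-1 : R).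
pose F p := if `[< box p `<=` U >] then box p else set0.
have -> : U = \bigcup_p F p.
  apply/seteqP; split=> [[x y] Uxy|z [p _]]; last first.
    by rewrite /F; case: ifPn => // /asboolP; exact.
  have /nbhs_ballP[e /= e0 eU] := open_nbhs_nbhs (conj oU Uxy).
  pose n := Num.truncn (2 / e).
  have ne : n.+1%:R^-1 < e / 2.
    rewrite invf_plt ?posrE ?divr_gt0 // invf_div; exact: truncnS_gt.
  have n0 : 0 < n.+1%:R^-1 :> R by rewrite invr_gt0.
  have rat_near (s : R) : exists q : rat, ball (ratr q : R) n.+1%:R^-1 s.
    have [u [/= su [q _ qu]]] := @dense_rat R _ (ex_intro _ s (ballxx s n0)) (ball_open _ _).
    by exists q; apply: ball_sym; rewrite qu.
  have ne2 : n.+1%:R^-1 + n.+1%:R^-1 <= e.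
    by rewrite [leRHS]splitr; apply: ltW; apply: ltrD.
  have [p Hp] := rat_near x; have [q Hq] := rat_near y.
  exists (p, q, n) => //; rewrite /F asboolT //.
  move=> [x' y'] [/= Bx By]; apply: eU; split => /=.
  - apply: (@le_ball _ _ _ (n.+1%:R^-1 + n.+1%:R^-1)); first exact: ne2.
    exact: ball_triangle (ball_sym Hp) Bx.
  - apply: (@le_ball _ _ _ (n.+1%:R^-1 + n.+1%:R^-1)); first exact: ne2.
    exact: ball_triangle (ball_sym Hq) By.
apply: countable_bigcupT_measurable => // p; rewrite /F; case: ifP => // _.
apply: measurableX; exact: (open_measurable (ball_open _ _)).
Qed.

Lemma continuous_measurable2 Om f : open Om ->
  (forall z, Om z -> {for z, continuous f}) -> measurable_fun (Om : set R2) f.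
Proof.
move=> oO cf; apply: (measurability _ (RGenOpens.measurableE R)).
move=> _ [_ [a [b ->] <-]]; apply: open_measurable2; rewrite openE => z [Oz fz].
apply: filterI; first exact: open_nbhs_nbhs.
by apply: cf => //; apply: open_nbhs_nbhs; split => //; exact: interval_open.
Qed.

Lemma sm_measurable Om f : open Om -> smooth_on Om f -> measurable_fun (Om : set R2) f.
Proof.
by move=> oO sf; apply: continuous_measurable2 => // z; exact: sm_continuous.
Qed.

Lemma continuous_sqnorm : continuous (fun z : R * R => z.1 ^+ 2 + z.2 ^+ 2).
Proof.
move=> z; apply: (@sm_continuous _ setT (fun z : R * R => z.1 ^+ 2 + z.2 ^+ 2)) => //.
by apply: sm_add; apply: sm_pow; [exact: sm_fst|exact: sm_snd].
Qed.

Lemma disk_open : open (disk R).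
Proof.
apply: (@open_comp _ _ (fun z : R * R => z.1 ^+ 2 + z.2 ^+ 2) [set x | x < 1]).
  by move=> z _; exact: continuous_sqnorm.
exact: open_lt.
Qed.

Lemma disk_measurable : measurable (disk R : set R2).
Proof. by apply: open_measurable2; exact: disk_open. Qed.

Lemma closed_sqnorm_le (r : R) : closed [set z : R * R | z.1 ^+ 2 + z.2 ^+ 2 <= r].
Proof.
apply: (@closed_comp _ _ (fun z : R * R => z.1 ^+ 2 + z.2 ^+ 2) [set x | x <= r]).
  by move=> z _; exact: continuous_sqnorm.
exact: closed_le.
Qed.

Definition square : set (R * R) := `[-1, 1]%classic `*` `[-1, 1]%classic.

Lemma square_compact : compact square.
Proof. by apply: compact_setX; exact: segment_compact. Qed.

Lemma square_measurable : measurable (square : set R2).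
Proof. by apply: measurableX; exact: measurable_itv. Qed.

Lemma sqnorm_square z : z.1 ^+ 2 + z.2 ^+ 2 <= 1 -> square z.
Proof. by move=> z1; split; rewrite /= in_itv /=; apply/andP; split; nra. Qed.

Lemma disk_square : disk R `<=` square.
Proof. by move=> z /ltW; exact: sqnorm_square. Qed.

Lemma square_lty : (lebesgue2 square < +oo)%E.
Proof.
rewrite /lebesgue2 /square product_measure1E; [|exact: measurable_itv..].
have mE : lebesgue_measure (`[-1, 1]%classic : set Rm) = 2%:E.
  have N11 : (-1 : R) < 1 by lra.
  by rewrite lebesgue_measure_itv /= lte_fin N11 -EFinB opprK.
set L := lebesgue_measure _ in mE.
by change (L * L < +oo)%E; rewrite mE -EFinM ltry.
Qed.

Lemma disk_lty : (lebesgue2 (disk R) < +oo)%E.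
Proof.
apply: le_lt_trans square_lty; apply: le_measure; rewrite ?inE.
- exact: disk_measurable.
- exact: square_measurable.
- exact: disk_square.
Qed.

(** Test functions have to be smooth on the whole plane, whereas the explicit ones make sense on
    [Om] only. The class [P] of extensions by zero is stable under partial derivatives, and this
    alone gives smoothness of every order. *)
Lemma sm_patch Om (F : set (R * R)) f : open Om -> closed F -> F `<=` Om ->
  smooth_on Om f -> (forall z, Om z -> ~ F z -> f z = 0) -> smooth (f \_ Om).
Proof.
move=> oO cF FO sf f0.
pose P h := exists2 g, smooth_on Om g /\ (forall z, Om z -> ~ F z -> g z = 0) & h = g \_ Om.
have P_near h z : P h -> Om z -> forall g, h = g \_ Om -> \near z, g z = h z.
  move=> _ Oz g ->; near=> y; rewrite patchE mem_set //.
  by near: y; exact: open_nbhs_nbhs.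
(* A point outside [Om] may lie on its boundary; it is the complement of the closed set [F] that
   provides a neighbourhood on which the extension vanishes. *)
have P_near0 h z : P h -> ~ Om z -> \near z, (cst 0 : R * R -> R) z = h z.
  move=> [g [sg g0] ->] nOz; near=> y.
  have nF : ~ F y.
    near: y; apply: open_nbhs_nbhs; split; first exact: closed_openC.
    by move=> /FO.
  by rewrite patchE; case: ifPn => // /set_mem Oy; rewrite g0.
have PD h i : P h -> exists2 h', P h' & forall z, is_derive z (dir i) h (h' z).
  move=> Ph; have [g [sg g0] hE] := Ph; have [g' sg' dg] := sm_partial i sg.
  exists (g' \_ Om).
    exists g' => //; split => // z Oz nFz.
    have [_ <-] := dg z Oz; have [_ <-] // : is_derive z (dir i) g 0.
    apply: (@near_eq_is_derive R _ R (cst 0)).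
    near=> y; rewrite g0 //; near: y; apply: open_nbhs_nbhs; split => //.
    exact: closed_openC.
  move=> z; rewrite patchE; case: ifPn => [/set_mem Oz|/negP nOz].
    by apply: near_eq_is_derive (dg z Oz); exact: P_near.
  apply: (@near_eq_is_derive R _ R (cst 0)).
  by apply: P_near0 => // Oz; apply: nOz; exact: mem_set.
have PC h : P h -> continuous h.
  move=> Ph z; have [g [sg g0] hE] := Ph.
  have [Oz|nOz] := pselect (Om z).
    have E : {near z, g =1 h} by exact: P_near.
    apply: cvg_trans (near_eq_cvg E) _.
    rewrite hE patchE mem_set //; exact: (sm_continuous sg).
  have E : {near z, (cst 0 : R * R -> R) =1 h} by exact: P_near0.
  apply: cvg_trans (near_eq_cvg E) _.
  rewrite hE patchE memNset //; exact: cvg_cst.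
move=> s; have {f0 sf} : P (foldr partial (f \_ Om) s).
  elim: s => [|i s IH] /=; first by exists f.
  have [h' Ph' dh] := PD _ i IH.
  rewrite (_ : partial _ _ = h') //; apply/funext => z.
  by have [] := dh z.
move=> Ph h; split; first exact: PC.
by move=> z i; have [h' _ dh] := PD _ i Ph; have [] := dh z.
Unshelve. all: by end_near. Qed.

(** * Test functions of the disk *)

Lemma sm_test (F : set (R * R)) f : closed F -> F `<=` disk R -> smooth_on (disk R) f ->
  (forall z, disk R z -> ~ F z -> f z = 0) -> test_function (disk R) (f \_ (disk R)).
Proof.
move=> cF FD sf f0.
have S : closure [set x | (f \_ (disk R)) x != 0] `<=` F.
  rewrite [X in _ `<=` X](closure_id F).1 //; apply: closureS => z /=.
  rewrite patchE; case: ifPn => [/set_mem Dz|]; last by rewrite eqxx.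
  by apply: contra_neqP; exact: f0.
split.
- exact: (sm_patch disk_open cF).
- apply: subclosed_compact square_compact _; first exact: closed_closure.
  by move=> z /S /FD; exact: disk_square.
- exact: subset_trans FD.
Qed.

Lemma test_outside f z : test_function (disk R) f -> ~ disk R z -> f z = 0.
Proof.
move=> [_ _ S] nD; apply/eqP/negPn/negP => fz; apply/nD/S.
exact: subset_closure.
Qed.

Lemma test_partial i f : test_function (disk R) f -> test_function (disk R) (partial i f).
Proof.
move=> [sf cf Sf].
have S : closure [set x | partial i f x != 0] `<=` closure [set x | f x != 0].
  rewrite [X in _ `<=` X](closure_id _).1; last exact: closed_closure.
  apply: closureS => z /=; apply: contraNP => nz.
  rewrite /partial (@near_eq_derive _ _ _ _ (cst 0)) ?derive_cst //.
  near=> y; apply/eqP/negPn/negP => fy.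
  have : ~ closure [set x | f x != 0] y.
    near: y; apply: open_nbhs_nbhs; split => //.
    by apply: closed_openC; exact: closed_closure.
  by apply; exact: subset_closure.
split.
- by move=> s; have := sf (rcons s i); rewrite foldr_rcons.
- by apply: subclosed_compact cf S; exact: closed_closure.
- exact: subset_trans Sf.
Unshelve. all: by end_near. Qed.

Lemma test_bounded f : test_function (disk R) f -> exists M, forall z, `|f z| <= M.
Proof.
move=> tf; have [/(_ [::])[/= cf _] cptf S] := tf.
have /compact_bounded[M [_ HM]] := continuous_compact (continuous_subspaceT cf) square_compact.
exists (Num.max (M + 1) 0) => z.
have [/disk_square Dz|nD] := pselect (disk R z).
  by rewrite le_max HM ?ltrDl //; exists z.
by rewrite (test_outside tf nD) normr0 le_max lexx orbT.
Qed.

Lemma test_integrable f : test_function (disk R) f ->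
  lebesgue2.-integrable setT (EFin \o f).
Proof.
move=> tf; have [/(_ [::])[/= cf _] _ _] := tf; have [M HM] := test_bounded tf.
have mf : measurable_fun (setT : set R2) f
  by apply: continuous_measurable2; [exact: openT|move=> z _; exact: cf].
have E : (EFin \o f) \_ (disk R) = EFin \o f.
  apply/funext => z; rewrite patchE; case: ifPn => // /negP nD.
  by rewrite /= (test_outside tf) // => /mem_set.
rewrite -E; apply/(integrable_mkcond _ disk_measurable).1.
apply: measurable_bounded_integrable => //.
- exact: disk_measurable.
- exact: disk_lty.
- exact: measurable_funS mf.
- by exists M; split; rewrite ?num_real // => N MN z _ /=; rewrite (le_trans (HM z)) // ltW.
Qed.

Lemma line_integral0 (F f : R -> R) :
  (forall x : R, is_derive x (1 : R) F (f x)) -> continuous f ->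
  (forall x : R, 1 <= `|x| -> F x = 0 /\ f x = 0) ->
  (\int[lebesgue_measure]_(x in [set: R]) (f x)%:E = 0)%E.
Proof.
move=> dF cf f0.
have <- : (fun x : Rm => (f x)%:E) \_ `[-1, 1]%classic = (fun x => (f x)%:E).
  apply/funext => x; rewrite patchE /= mem_setE in_itv /=; case: ifPn => // nx.
  rewrite (f0 x _).2 //; move: nx; rewrite -ler_norml -ltNge; exact: ltW.
have N11 : (-1 : R) < 1 by lra.
rewrite -integral_mkcond (@FTC2 F) //.
  by rewrite (f0 1 _).1 ?normr1 // (f0 (-1) _).1 ?normrN ?normr1 // subr0.
by move=> x _; exact: cf.
Qed.

(** Fubini with the direction of differentiation innermost: on each line the inner integral is a
    difference of values of f at points where a coordinate has modulus 1, outside the open disk. *)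
Lemma int_partial i f : test_function (disk R) f ->
  \int[lebesgue2]_(z in disk R) partial i f z = 0.
Proof.
move=> tf; have tf' := test_partial i tf; have [sf _ _] := tf.
have If := test_integrable tf'.
have df z : is_derive z (dir i) f (partial i f z).
  by apply: derivableP; have [_] := sf [::]; exact.
have df' z : is_derive z (dir i) (partial i f) (partial i (partial i f) z).
  by apply: derivableP; have [_] := sf [:: i]; exact.
have out (x y : R) : 1 <= `|x| \/ 1 <= `|y| -> ~ disk R (x, y).
  rewrite /disk /=; case=> H; apply/negP; rewrite -leNgt.
    rewrite -[x ^+ 2]real_normK ?num_real //; have := sqr_ge0 y; nra.
  rewrite -[y ^+ 2]real_normK ?num_real //; have := sqr_ge0 x; nra.
rewrite Rintegral_mkcond (_ : _ \_ _ = partial i f); last first.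
  apply/funext => z; rewrite patchE; case: ifPn => // /negP nD.
  by rewrite (test_outside tf') // => /mem_set.
rewrite /Rintegral; case: i df df' If tf' => df df' If tf'.
- rewrite -integral12_prod_meas1 // integral0_eq // => x _.
  apply: (@line_integral0 (fun y => f (x, y))).
  + by move=> y; apply: is_derive_slice2; exact: df.
  + by move=> y; apply: is_derive1_continuous; apply: is_derive_slice2; exact: df'.
  + move=> y y1; split; [apply: (test_outside tf)|apply: (test_outside tf')]; apply: out; by right.
- rewrite -integral21_prod_meas1 // integral0_eq // => y _.
  apply: (@line_integral0 (fun x => f (x, y))).
  + by move=> x; apply: is_derive_slice1; exact: df.
  + by move=> x; apply: is_derive1_continuous; apply: is_derive_slice1; exact: df'.
  + move=> x x1; split; [apply: (test_outside tf)|apply: (test_outside tf')]; apply: out; by left.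
Qed.

Lemma test_mul f g : smooth_on (disk R) g -> test_function (disk R) f ->
  test_function (disk R) ((fun z => g z * f z) \_ (disk R)).
Proof.
move=> sg [sf cf Sf]; apply: sm_test Sf _ _; first exact: closed_closure.
  by apply: sm_mul => //; exact: sm_smooth.
move=> z _ nS; rewrite (_ : f z = 0) ?mulr0 //; apply/eqP/negPn/negP => fz.
by apply/nS/subset_closure.
Qed.

Lemma integrable_mul_test f g : smooth_on (disk R) g -> test_function (disk R) f ->
  lebesgue2.-integrable (disk R) (EFin \o (fun z => g z * f z)).
Proof.
move=> sg tf; have /test_integrable := test_mul sg tf.
rewrite -restrict_EFin; exact: (integrable_mkcond _ disk_measurable).2.
Qed.

Lemma partialE i f z (d : R) : is_derive z (dir i) f d -> partial i f z = d.
Proof. by case. Qed.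

(** The function g may blow up at the circle; only its product with f, extended by zero, is
    differentiated on the plane, and [int_partial] applies to this product. *)
Lemma ibp i f g g' : smooth_on (disk R) g -> smooth_on (disk R) g' ->
  (forall z, disk R z -> is_derive z (dir i) g (g' z)) -> test_function (disk R) f ->
  \int[lebesgue2]_(z in disk R) (g z * partial i f z) =
  - \int[lebesgue2]_(z in disk R) (g' z * f z).
Proof.
move=> sg sg' dg tf; have tf' := test_partial i tf.
apply/eqP; rewrite -addr_eq0 -RintegralD; last 3 first.
- exact: disk_measurable.
- exact: integrable_mul_test.
- exact: integrable_mul_test.
apply/eqP; rewrite -[RHS](int_partial i (test_mul sg tf)); apply: eq_Rintegral.
move=> z /set_mem Dz; apply/esym/partialE.
apply: (@near_eq_is_derive R _ R (fun z => g z * f z)).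
  near=> y; rewrite patchE mem_set //; near: y; apply: open_nbhs_nbhs.
  by split => //; exact: disk_open.
apply: is_derive_val (is_derive_mul (dg z Dz) (derivableP _)) _.
  by have [/(_ [::])[_ ]] := tf; exact.
by rewrite (mulrC (f z)).
Unshelve. all: by end_near. Qed.

Lemma weak_partial_sm i f g : smooth_on (disk R) g -> smooth_on (disk R) f ->
  (forall z, disk R z -> is_derive z (dir i) f (g z)) -> weak_partial (disk R) i f g.
Proof. by move=> sg sf df phi tphi; exact: ibp. Qed.

End Integral.

(** * Conformal strip coordinates *)

Section Strip.
Context {R : realType}.
Implicit Types (s : R) (z : R * R) (i : bool).

(* (1+s^2)^(1/16): all the powers of 1+s^2 that occur are natural powers of [Wt] or
   of its inverse. *)
Definition Wt s : R := expR (ln (1 + s ^+ 2) / 16%:R).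

Lemma sqr1_gt0 s : 0 < 1 + s ^+ 2.
Proof. by have := sqr_ge0 s; lra. Qed.

Lemma Wt_gt0 s : 0 < Wt s. Proof. exact: expR_gt0. Qed.

Lemma Wt_neq0 s : Wt s != 0. Proof. by rewrite gt_eqF ?Wt_gt0. Qed.

Lemma Wt16 s : Wt s ^+ 16 = 1 + s ^+ 2.
Proof.
rewrite /Wt -expRM_natl mulrC divfK ?pnatr_eq0 //.
by rewrite lnK ?posrE ?sqr1_gt0.
Qed.

Lemma Wt_ge1 s : 1 <= Wt s.
Proof.
rewrite -(@ler_pXn2r R 16) ?nnegrE ?(ltW (Wt_gt0 s)) // expr1n Wt16.
by have := sqr_ge0 s; lra.
Qed.

Lemma norm_le_Wt8 s : `|s| <= Wt s ^+ 8.
Proof.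
rewrite -(@ler_pXn2r R 2) ?nnegrE ?exprn_ge0 ?(ltW (Wt_gt0 s)) //.
by rewrite -exprM Wt16 real_normK ?num_real //; lra.
Qed.

Lemma is_derive_Wt s : is_derive s (1 : R) Wt (s / (8%:R * Wt s ^+ 15)).
Proof.
have D : is_derive s (1 : R) (fun s : R => 1 + s ^+ 2) (2%:R * s).
  apply: is_derive_val (is_derive_add (is_derive_cst _ _ _) (is_derive_exp 2 (is_derive_id _ _))) _.
  by rewrite /= expr1; ring.
have D2 := @is_derive_comp R R (@ln R) (fun s => 1 + s ^+ 2) s 1 _ _ (is_derive1_ln (sqr1_gt0 s)) D.
have := is_derive_comp (is_derive_expR _) (is_derive_mul D2 (is_derive_cst (16%:R^-1 : R) _ _)).
move=> /is_derive_val; apply.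
rewrite -/(Wt s) -Wt16; have := Wt_neq0 s => W0.
by rewrite /cst; field.
Qed.

(* phi = [Phit] o t, with phi' = [Pt] and phi'' = [dPt]; the phase [psit] is chosen
   so that - phi'' = psi' (1+s^2)^(-5/8) / 2 holds exactly. *)
Definition Pt s : R := (8%:R / 3%:R + 2%:R * s ^+ 2) / Wt s ^+ 18.
Definition dPt s : R := - (s * (s ^+ 2 + 4%:R) / (2%:R * Wt s ^+ 34)).
Definition Phit s : R := 8%:R / 3%:R * s / Wt s ^+ 2.
Definition psit s : R := Wt s ^+ 8 - 3%:R / Wt s ^+ 8.
Definition dpsit s : R := s * (s ^+ 2 + 4%:R) / Wt s ^+ 24.

(** The profiles [Phit], [Pt], [Et], [Ft] and the correction in [psit] are all quotients by a power
    of [Wt], and are differentiated by this one rule. *)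
Lemma is_derive_divW k (f : R -> R) df s : is_derive s (1 : R) f df ->
  is_derive s (1 : R) (fun s => f s / Wt s ^+ k)
    (df / Wt s ^+ k - k%:R * f s * s / (8%:R * Wt s ^+ (k + 16))).
Proof.
move=> Df; have W0 := Wt_neq0 s.
have D := @is_derive_inv R R (fun s => Wt s ^+ k) s 1 _ (expf_neq0 k W0) (is_derive_exp k (is_derive_Wt s)).
apply: is_derive_val (is_derive_mul Df D) _.
case: k D => [|k] D; first by rewrite /= !mul0r !expr0; ring.
rewrite addSn addnC /= [Wt s ^+ (16 + k).+1]exprS [Wt s ^+ (16 + k)]exprD.
rewrite [Wt s ^+ k.+1]exprS.
have Wk := expf_neq0 k W0.
by field; rewrite W0 Wk.
Qed.

Lemma is_derive_Phit s : is_derive s (1 : R) Phit (Pt s).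
Proof.
have D := is_derive_divW 2 (is_derive_mul (is_derive_cst (8%:R / 3%:R : R) s 1) (is_derive_id s (1 : R))).
apply: is_derive_val D _; rewrite /Pt /cst.
have := Wt16 s; have := Wt_neq0 s; set W := Wt s => W0 W16.
(* The first equality holds with W and s independent; the relation W^16 = 1 + s^2 enters only
   afterwards, in the numerator. *)
transitivity ((8%:R / 3%:R * W ^+ 16 - 2%:R / 3%:R * s ^+ 2) / W ^+ 18); first by field.
by rewrite W16; congr (_ / _); field.
Qed.

Lemma is_derive_Pt s : is_derive s (1 : R) Pt (dPt s).
Proof.
have D := is_derive_divW 18 (is_derive_add (is_derive_cst (8%:R / 3%:R : R) s 1)
  (is_derive_mul (is_derive_cst (2%:R : R) s 1) (is_derive_exp 2 (is_derive_id s (1 : R))))).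
apply: is_derive_val D _; rewrite /dPt /cst.
have := Wt16 s; have := Wt_neq0 s; set W := Wt s => W0 W16.
transitivity ((4%:R * s * W ^+ 16 - (6%:R + 9%:R / 2%:R * s ^+ 2) * s) / W ^+ 34).
  by rewrite /=; field.
by rewrite W16; field.
Qed.

(** Since [Wt] to the power 8 is sqrt(1+s^2), the main term contributes s W^16 / W^24 and the
    correction 3 s / W^24. The coefficient 3 thus produces the factor s^2 + 4 of phi''. *)
Lemma is_derive_psit s : is_derive s (1 : R) psit (dpsit s).
Proof.
have D := is_derive_add (is_derive_exp 8 (is_derive_Wt s))
  (is_derive_opp (is_derive_divW 8 (is_derive_cst (3%:R : R) s 1))).
apply: is_derive_val D _; rewrite /dpsit /cst.
have := Wt16 s; have := Wt_neq0 s; set W := Wt s => W0 W16.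
transitivity (s * (W ^+ 16 + 3%:R) / W ^+ 24); first by rewrite /=; field.
by rewrite W16; field.
Qed.

Definition Et s : R := sin (psit s) / Wt s ^+ 5.
Definition Ft s : R := cos (psit s) / Wt s ^+ 5.
Definition dEt s : R :=
  cos (psit s) * dpsit s / Wt s ^+ 5 - 5%:R * sin (psit s) * s / (8%:R * Wt s ^+ 21).
Definition dFt s : R :=
  - sin (psit s) * dpsit s / Wt s ^+ 5 - 5%:R * cos (psit s) * s / (8%:R * Wt s ^+ 21).

Lemma is_derive_Et s : is_derive s (1 : R) Et (dEt s).
Proof. exact: (is_derive_divW 5 (is_derive_comp (is_derive_sin _) (is_derive_psit s))). Qed.

Lemma is_derive_Ft s : is_derive s (1 : R) Ft (dFt s).
Proof. exact: (is_derive_divW 5 (is_derive_comp (is_derive_cos _) (is_derive_psit s))). Qed.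

(** For E = r sin psi and F = r cos psi the terms in r' cancel and E' F - E F' = r^2 psi'; here r^2
    is [Wt] to the power -10. *)
Lemma wronskian s : dEt s * Ft s - Et s * dFt s = - (2%:R * dPt s).
Proof.
rewrite /dEt /dFt /Et /Ft /dPt.
transitivity ((cos (psit s) ^+ 2 + sin (psit s) ^+ 2) * dpsit s / Wt s ^+ 10).
  by have := Wt_neq0 s => W0; field.
by rewrite cos2Dsin2 /dpsit; have := Wt_neq0 s => W0; field.
Qed.

Lemma Pt_ge0 s : 0 <= Pt s.
Proof.
by rewrite divr_ge0 ?exprn_ge0 ?(ltW (Wt_gt0 s)) //; have := sqr_ge0 s; lra.
Qed.

Lemma Pt_le s : Pt s <= 3%:R / Wt s ^+ 2.
Proof.
rewrite ler_pdivrMr ?exprn_gt0 ?Wt_gt0 //.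
have -> : 3%:R / Wt s ^+ 2 * Wt s ^+ 18 = 3%:R * Wt s ^+ 16.
  by have := Wt_neq0 s => W0; field.
by rewrite Wt16; have := sqr_ge0 s; lra.
Qed.

Lemma invWt_le1 k s : (Wt s ^+ k)^-1 <= 1.
Proof. by rewrite invf_le1 ?exprn_gt0 ?Wt_gt0 // exprn_ege1 ?Wt_ge1. Qed.

Lemma dPt_le s : `|dPt s| <= 2%:R / Wt s ^+ 10.
Proof.
have W0 := Wt_gt0 s; have Wn0 := Wt_neq0 s.
rewrite /dPt normrN normrM normfV (ger0_norm (_ : 0 <= 2%:R * _)); last first.
  by rewrite mulr_ge0 ?exprn_ge0 ?ltW.
rewrite ler_pdivrMr ?mulr_gt0 ?exprn_gt0 //.
have -> : 2%:R / Wt s ^+ 10 * (2%:R * Wt s ^+ 34) = Wt s ^+ 8 * (4%:R * Wt s ^+ 16).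
  by field.
rewrite normrM ler_pM ?norm_le_Wt8 // Wt16 ger0_norm; last by have := sqr_ge0 s; lra.
by have := sqr_ge0 s; lra.
Qed.

Lemma norm_dpsit_le s : `|dpsit s| <= 4%:R.
Proof.
have W0 := Wt_gt0 s; have Wn0 := Wt_neq0 s.
rewrite /dpsit normrM normfV (ger0_norm (exprn_ge0 24 (ltW W0))).
rewrite ler_pdivrMr ?exprn_gt0 //.
have -> : 4%:R * Wt s ^+ 24 = Wt s ^+ 8 * (4%:R * Wt s ^+ 16) by ring.
rewrite normrM ler_pM ?norm_le_Wt8 // Wt16 ger0_norm; last by have := sqr_ge0 s; lra.
by have := sqr_ge0 s; lra.
Qed.

(** Stated for general c and d to serve both pairs, (cos, sin) for [dEt] and (-sin, cos) for [dFt].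
    The constant 25 comes from 4 + 5/8 <= 5. *)
Lemma EF_le (c d s : R) : `|c| <= 1 -> `|d| <= 1 ->
  (c * dpsit s / Wt s ^+ 5 - 5%:R * d * s / (8%:R * Wt s ^+ 21)) ^+ 2 <= 25%:R / Wt s ^+ 10.
Proof.
move=> c1 d1; have W0 := Wt_gt0 s; have Wn0 := Wt_neq0 s.
have -> : c * dpsit s / Wt s ^+ 5 - 5%:R * d * s / (8%:R * Wt s ^+ 21) =
  (c * dpsit s - 5%:R / 8%:R * (d * (s / Wt s ^+ 16))) / Wt s ^+ 5 by field.
rewrite expr_div_n -exprM ler_wpM2r ?invr_ge0 ?exprn_ge0 ?ltW //.
have H1 : `|c * dpsit s| <= 4%:R.
  rewrite normrM -[leRHS]mul1r ler_pM // norm_dpsit_le //.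
have H2 : `|d * (s / Wt s ^+ 16)| <= 1.
  rewrite normrM -[leRHS]mul1r ler_pM // normrM normfV (ger0_norm (exprn_ge0 16 (ltW W0))).
  rewrite ler_pdivrMr ?exprn_gt0 // mul1r (le_trans (norm_le_Wt8 s)) //.
  by rewrite ler_weXn2l ?Wt_ge1.
move: H1 H2; rewrite !ler_norml => /andP[? ?] /andP[? ?]; nra.
Qed.

Lemma norm_cos_le1 s : `|cos s| <= 1.
Proof. by rewrite ler_norml cos_geN1 cos_le1. Qed.

Lemma norm_sin_le1 s : `|sin s| <= 1.
Proof. by rewrite ler_norml sin_geN1 sin_le1. Qed.

Lemma dEt_le s : dEt s ^+ 2 <= 25%:R / Wt s ^+ 10.
Proof. by apply: EF_le; [exact: norm_cos_le1|exact: norm_sin_le1]. Qed.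

Lemma dFt_le s : dFt s ^+ 2 <= 25%:R / Wt s ^+ 10.
Proof. by apply: EF_le; rewrite ?normrN; [exact: norm_sin_le1|exact: norm_cos_le1]. Qed.

Lemma Et_le s : Et s ^+ 2 <= 1 / Wt s ^+ 10.
Proof.
rewrite /Et expr_div_n -exprM; apply: ler_wpM2r; first by rewrite invr_ge0 exprn_ge0 // ltW // Wt_gt0.
by rewrite -real_normK ?num_real // exprn_ile1 // norm_sin_le1.
Qed.

Lemma Ft_le s : Ft s ^+ 2 <= 1 / Wt s ^+ 10.
Proof.
rewrite /Ft expr_div_n -exprM; apply: ler_wpM2r; first by rewrite invr_ge0 exprn_ge0 // ltW // Wt_gt0.
by rewrite -real_normK ?num_real // exprn_ile1 // norm_cos_le1.
Qed.

(** * The conformal map and its derivatives on the disk *)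

Definition sA z : R := (1 + z.1) ^+ 2 + z.2 ^+ 2.
Definition sB z : R := (1 - z.1) ^+ 2 + z.2 ^+ 2.
Definition dsk z : R := 1 - z.1 ^+ 2 - z.2 ^+ 2.

Lemma dsk_gt0 z : disk R z -> 0 < dsk z.
Proof. rewrite /disk /dsk /=; lra. Qed.

(** Both sides are the squared modulus of (1+z)(1-conj z), whose real part is [dsk z] and whose
    imaginary part is 2 z.2; this is also why [thz] is the arctangent of their quotient. *)
Lemma sAB z : sA z * sB z = dsk z ^+ 2 + (2%:R * z.2) ^+ 2.
Proof. by rewrite /sA /sB /dsk; ring. Qed.

Lemma sA_gt0 z : disk R z -> 0 < sA z.
Proof. by rewrite /disk /sA /= => Dz; have := sqr_ge0 z.2; nra. Qed.

Lemma sB_gt0 z : disk R z -> 0 < sB z.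
Proof. by rewrite /disk /sB /= => Dz; have := sqr_ge0 z.2; nra. Qed.

(** [tz] and [thz] are the real and imaginary parts of the conformal map
    log((1+z)/(1-z)) of the disk onto the strip of height pi. *)
Definition tz z : R := (ln (sA z) - ln (sB z)) / 2%:R.
Definition thz z : R := atan (2%:R * z.2 / dsk z).
Definition tx z : R := 2%:R * (1 - z.1 ^+ 2 + z.2 ^+ 2) / (sA z * sB z).
Definition ty z : R := - (4%:R * z.1 * z.2) / (sA z * sB z).
(** The squared modulus of 2/(1-z^2), the derivative of the conformal map: both the squared length
    of the gradient of t and the Jacobian of (t, theta). *)
Definition gt2 z : R := 4%:R / (sA z * sB z).

Definition tgrad i z := if i then ty z else tx z.
(** The Cauchy-Riemann equations are built in: the gradient of theta is that of t rotated by a right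
    angle. *)
Definition thgrad i z := if i then tx z else - ty z.

Lemma gt2E z : disk R z -> tx z ^+ 2 + ty z ^+ 2 = gt2 z.
Proof.
move=> Dz; have := gt_eqF (sA_gt0 Dz); have := gt_eqF (sB_gt0 Dz).
rewrite /tx /ty /gt2 /sA /sB => B0 A0.
by field; rewrite B0 A0.
Qed.

Lemma is_derive_sA i z : is_derive z (dir i) sA (if i then 2%:R * z.2 else 2%:R * (1 + z.1)).
Proof.
apply: is_derive_val (is_derive_add (is_derive_exp 2 (is_derive_add (is_derive_cst (1 : R) _ _) (is_derive_fst _ _)))
  (is_derive_exp 2 (is_derive_snd _ _))) _.
by case: i => /=; ring.
Qed.

Lemma is_derive_sB i z : is_derive z (dir i) sB (if i then 2%:R * z.2 else - (2%:R * (1 - z.1))).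
Proof.
apply: is_derive_val (is_derive_add (is_derive_exp 2 (is_derive_add (is_derive_cst (1 : R) _ _) (is_derive_opp (is_derive_fst _ _))))
  (is_derive_exp 2 (is_derive_snd _ _))) _.
by case: i => /=; ring.
Qed.

Lemma is_derive_dsk i z : is_derive z (dir i) dsk (- (2%:R * (if i then z.2 else z.1))).
Proof.
apply: is_derive_val (is_derive_add (is_derive_add (is_derive_cst (1 : R) _ _) (is_derive_opp (is_derive_exp 2 (is_derive_fst _ _))))
  (is_derive_opp (is_derive_exp 2 (is_derive_snd _ _)))) _.
by case: i => /=; ring.
Qed.

Lemma is_derive_tz i z : disk R z -> is_derive z (dir i) tz (tgrad i z).
Proof.
move=> Dz; have := gt_eqF (sA_gt0 Dz); have := gt_eqF (sB_gt0 Dz) => B0 A0.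
apply: is_derive_val (is_derive_mul (is_derive_add (is_derive_comp (is_derive1_ln (sA_gt0 Dz)) (is_derive_sA i z))
   (is_derive_opp (is_derive_comp (is_derive1_ln (sB_gt0 Dz)) (is_derive_sB i z)))) (is_derive_cst (2%:R^-1 : R) _ _)) _.
rewrite /cst /tgrad /tx /ty.
by case: i; move: B0 A0; rewrite /sA /sB => B0 A0; field; rewrite B0 A0.
Qed.

Lemma is_derive_thz i z : disk R z -> is_derive z (dir i) thz (thgrad i z).
Proof.
move=> Dz; have := gt_eqF (sA_gt0 Dz); have := gt_eqF (sB_gt0 Dz) => B0 A0.
have d0 := gt_eqF (dsk_gt0 Dz).
apply: is_derive_val (is_derive_comp (is_derive1_atan _) (is_derive_mul (is_derive_mul (is_derive_cst (2%:R : R) _ _) (is_derive_snd _ _))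
  (is_derive_inv (negbT d0) (is_derive_dsk i z)))) _.
rewrite /cst /thgrad /tx /ty sAB.
have N0 : dsk z ^+ 2 + (2%:R * z.2) ^+ 2 != 0 by rewrite -sAB mulf_neq0 ?A0 ?B0.
by case: i => /=; rewrite /dsk in d0 N0 *; field; rewrite ?d0 ?N0.
Qed.

(** The second derivative of t in the first variable; the harmonicity of t is the opposite sign in
    [is_derive_tyy]. *)
Definition lap_tx z : R := - (4%:R * z.1) / (sA z * sB z)
  - 2%:R * (1 - z.1 ^+ 2 + z.2 ^+ 2) * (- (4%:R * z.1 * dsk z)) / (sA z * sB z) ^+ 2.

Lemma is_derive_AB i z : is_derive z (dir i) (fun z => sA z * sB z)
  (if i then - (4%:R * z.2 * dsk z) + 8%:R * z.2 else - (4%:R * z.1 * dsk z)).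
Proof.
apply: is_derive_val (is_derive_mul (is_derive_sA _ _) (is_derive_sB _ _)) _.
by rewrite /sA /sB /dsk; case: i; ring.
Qed.

Lemma is_derive_txx z : disk R z -> is_derive z (dir false) tx (lap_tx z).
Proof.
move=> Dz; have := gt_eqF (sA_gt0 Dz); have := gt_eqF (sB_gt0 Dz) => B0 A0.
have N0 : sA z * sB z != 0 by rewrite mulf_neq0 ?A0 ?B0.
apply: is_derive_val (is_derive_mul (is_derive_mul (is_derive_cst (2%:R : R) _ _)
   (is_derive_add (is_derive_add (is_derive_cst (1 : R) _ _) (is_derive_opp (is_derive_exp 2 (is_derive_fst _ _))))
   (is_derive_exp 2 (is_derive_snd _ _)))) (@is_derive_inv R _ (fun z => sA z * sB z) _ _ _ N0 (is_derive_AB false z))) _.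
by rewrite /lap_tx /cst /=; field; rewrite A0 B0.
Qed.

Lemma is_derive_tyy z : disk R z -> is_derive z (dir true) ty (- lap_tx z).
Proof.
move=> Dz; have := gt_eqF (sA_gt0 Dz); have := gt_eqF (sB_gt0 Dz) => B0 A0.
have N0 : sA z * sB z != 0 by rewrite mulf_neq0 ?A0 ?B0.
apply: is_derive_val (is_derive_mul (is_derive_opp (is_derive_mul (is_derive_mul (is_derive_cst (4%:R : R) _ _)
   (is_derive_fst _ _)) (is_derive_snd _ _))) (@is_derive_inv R _ (fun z => sA z * sB z) _ _ _ N0 (is_derive_AB true z))) _.
rewrite /lap_tx /cst /=.
move: A0 B0; rewrite /sA /sB /dsk => A0 B0.
by field; rewrite A0 B0.
Qed.

End Strip.

(** * Logarithmic integrability *)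

Section Integrability.
Context {R : realType}.
Local Notation Rm := (measurableTypeR R).
Local Notation R2 := (measurableTypeR R * measurableTypeR R)%type.
Local Notation I11 := (`[(-1)%R, 1%R]%classic : set (measurableTypeR R)).
Local Notation mu := (@lebesgue_measure R).
Implicit Types (s e : R) (z : R * R) (i : bool).

Lemma square_tonelli (G : R * R -> \bar R) :
  measurable_fun (square : set R2) G -> (forall z, square z -> (0 <= G z)%E) ->
  measurable_fun I11 (fun x => \int[mu]_(y in I11) G (x, y))%E /\
  (\int[lebesgue2]_(z in square) G z = \int[mu]_(x in I11) \int[mu]_(y in I11) G (x, y))%E.
Proof.
move=> mG G0.
have mG' : measurable_fun (setT : set R2) (G \_ square).
  exact: (measurable_restrictT _ square_measurable).1.
have G'0 z : (0 <= (G \_ square) z)%E.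
  by rewrite patchE; case: ifPn => // /set_mem; exact: G0.
have E : fubini_F mu (G \_ square) = (fun x => \int[mu]_(y in I11) G (x, y))%E \_ I11.
  apply/funext => x; rewrite /fubini_F patchE; case: ifPn => [/set_mem xI|xI].
    rewrite [RHS]integral_mkcond; apply: eq_integral => y _.
    rewrite !patchE; congr (if _ then _ else _).
    by apply/idP/idP => /set_mem; [move=> [_ yI]; exact: mem_set|move=> yI; apply: mem_set].
  apply: integral0_eq => y _; rewrite patchE ifF //; apply/negP => /set_mem [/= xI' _].
  by move/negP: xI; apply; exact: mem_set.
have mI : measurable I11 := measurable_itv _.
split.
  by apply: (measurable_restrictT _ mI).2; rewrite -E; exact: measurable_fun_fubini_tonelli_F.
rewrite integral_mkcond [RHS]integral_mkcond -E.
by rewrite /lebesgue2 fubini_tonelli1.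
Qed.

Lemma square_tonelli_le (G : R * R -> \bar R) (H : R -> \bar R) :
  measurable_fun (square : set R2) G -> (forall z, square z -> (0 <= G z)%E) ->
  measurable_fun I11 H ->
  (forall x : R, (-1 <= x <= 1)%R -> \int[mu]_(y in I11) G (x, y) <= H x)%E ->
  (\int[lebesgue2]_(z in square) G z <= \int[mu]_(x in I11) H x)%E.
Proof.
move=> mG G0 mH GH; have [mF ->] := square_tonelli mG G0.
apply: ge0_le_integral => //.
by move=> x xI; apply: integral_ge0 => y yI; exact: G0.
Qed.

(* A logarithm of 1/s that stays >= 1 for all s >= 0. *)
Definition ell s : R := 1 + ln (1 + s^-1).
Definition r4 s : R := expR (ln s / 4%:R).

Lemma ell_ge1 s : 0 <= s -> 1 <= ell s.
Proof. by move=> s0; rewrite lerDl ln_ge0 // lerDl invr_ge0. Qed.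

Lemma ell_gt0 s : 0 <= s -> 0 < ell s.
Proof. by move/ell_ge1; apply: lt_le_trans. Qed.

Lemma ell_anti s u : 0 < s -> s <= u -> ell u <= ell s.
Proof.
move=> s0 su; have u0 := lt_le_trans s0 su.
rewrite lerD2l ler_ln ?posrE ?addr_gt0 ?invr_gt0 //.
by rewrite lerD2l lef_pV2 ?posrE.
Qed.

Lemma r4_gt0 s : 0 < r4 s. Proof. exact: expR_gt0. Qed.

Lemma r4K s : 0 < s -> r4 s ^+ 4 = s.
Proof.
by move=> s0; rewrite /r4 -expRM_natl mulrC divfK ?pnatr_eq0 // lnK ?posrE.
Qed.

Lemma r4_ge1 s : 1 <= s -> 1 <= r4 s.
Proof.
move=> s1; rewrite -(@ler_pXn2r R 4) ?nnegrE ?(ltW (r4_gt0 s)) // expr1n r4K //.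
exact: lt_le_trans s1.
Qed.

Lemma r4_le s u : 0 < s -> s <= u -> r4 s <= r4 u.
Proof.
move=> s0 su; rewrite -(@ler_pXn2r R 4) ?nnegrE ?(ltW (r4_gt0 _)) // !r4K //.
exact: lt_le_trans su.
Qed.

Lemma is_derive_ell s : 0 < s -> is_derive s (1 : R) ell (- (s * (s + 1))^-1).
Proof.
move=> s0; have sn0 : s != 0 by rewrite gt_eqF.
have p0 : 0 < 1 + s^-1 by rewrite addr_gt0 // invr_gt0.
have D := @is_derive_comp R R (@ln R) (fun s => 1 + s^-1) s 1 _ _ (is_derive1_ln p0)
   (is_derive_add (is_derive_cst (1 : R) _ _) (is_derive_inv sn0 (is_derive_id s (1 : R)))).
apply: is_derive_val (is_derive_add (is_derive_cst (1 : R) _ _) D) _.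
have s1 : s + 1 != 0 by rewrite gt_eqF // addr_gt0.
by field; rewrite s1 sn0.
Qed.

Lemma is_derive_r4 s : 0 < s -> is_derive s (1 : R) r4 ((4%:R * r4 s ^+ 3)^-1).
Proof.
move=> s0; have D := is_derive_comp (is_derive_expR _) (is_derive_mul (is_derive1_ln s0) (is_derive_cst (4%:R^-1 : R) _ _)).
apply: is_derive_val D _; rewrite -/(r4 s) /cst.
have r0 : r4 s != 0 by rewrite gt_eqF // r4_gt0.
rewrite -[in s^-1](r4K s0); set r := r4 s in r0 *.
by field.
Qed.

(* The squared distance to the boundary singularity o = 1 or -1. *)
Definition sig (o : R) z : R := (1 - o * z.1) ^+ 2 + z.2 ^+ 2.
(** The planar model ell^(-5/4)/sigma of an energy density at the singularity o, regularized by e: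
    [r4] is the fourth root. It is just integrable in the plane, because 5/4 > 1. *)
Definition Kf (o e : R) z : R := (r4 (ell (sig o z + e)) ^+ 5 * (sig o z + e))^-1.

Lemma sig_ge0 o z : 0 <= sig o z.
Proof. by rewrite addr_ge0 ?sqr_ge0. Qed.

Lemma sm_sig Om o : smooth_on Om (sig o).
Proof.
apply: sm_add; apply: sm_pow; last exact: sm_snd.
apply: sm_sub; first exact: sm_cst.
by apply: sm_mul; [exact: sm_cst|exact: sm_fst].
Qed.

Lemma sm_ell Om f : (forall z, Om z -> 0 < f z) -> smooth_on Om f -> smooth_on Om (fun z => ell (f z)).
Proof.
move=> f0 sf; apply: sm_add; first exact: sm_cst.
apply: sm_ln; first by move=> z /f0 fz; rewrite addr_gt0 // invr_gt0.
apply: sm_add; first exact: sm_cst.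
by apply: sm_inv => // z /f0 fz; rewrite gt_eqF.
Qed.

Lemma sm_r4 Om f : (forall z, Om z -> 0 < f z) -> smooth_on Om f -> smooth_on Om (fun z => r4 (f z)).
Proof.
move=> f0 sf; apply: sm_exp; apply: sm_mul; last exact: sm_cst.
exact: sm_ln.
Qed.

Lemma Kf_ge0 o e z : 0 <= e -> 0 <= Kf o e z.
Proof.
move=> e0; rewrite invr_ge0 mulr_ge0 ?exprn_ge0 ?(ltW (r4_gt0 _)) //.
by rewrite addr_ge0 // sig_ge0.
Qed.

Lemma sm_Kf (Om : set (R * R)) o e : 0 <= e -> (forall z, Om z -> 0 < sig o z + e) -> smooth_on Om (Kf o e).
Proof.
move=> e0 S0.
have ss : smooth_on Om (fun z => sig o z + e) by apply: sm_add; [exact: sm_sig|exact: sm_cst].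
apply: sm_inv.
  by move=> z Oz; rewrite mulf_neq0 ?expf_neq0 ?gt_eqF ?r4_gt0 ?S0.
apply: sm_mul => //; apply: sm_pow; apply: sm_r4; last exact: sm_ell.
by move=> z /S0 /ltW; exact: ell_gt0.
Qed.

Lemma itv_measurable (f : R -> R) :
  (forall x, -1 <= x <= 1 -> {for x, continuous f}) -> measurable_fun I11 f.
Proof.
move=> cf; apply: subspace_continuous_measurable_fun; first exact: measurable_itv.
by apply: continuous_in_subspaceT => x /[!inE] /=; rewrite in_itv /=; exact: cf.
Qed.

Lemma atan_cont (d y : R) : 0 < d -> {for y, continuous (fun y : R => (y ^+ 2 + d ^+ 2)^-1)}.
Proof.
move=> d0; have p0 : y ^+ 2 + d ^+ 2 != 0 by rewrite gt_eqF // ltr_wpDl ?sqr_ge0 // exprn_gt0.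
have D2 := is_derive_add (is_derive_exp 2 (is_derive_id y (1 : R))) (is_derive_cst (d ^+ 2 : R) y 1).
have D3 := @is_derive_inv R _ (fun y : R => y ^+ 2 + d ^+ 2) y 1 _ p0 D2.
exact: (is_derive1_continuous D3).
Qed.

Lemma atan_int (d : R) : 0 < d ->
  (\int[mu]_(y in I11) ((y ^+ 2 + d ^+ 2)^-1)%:E <= (4%:R / d)%:E)%E.
Proof.
move=> d0; have dn0 : d != 0 by rewrite gt_eqF.
have p0 (y : R) : 0 < y ^+ 2 + d ^+ 2 by rewrite ltr_wpDl ?sqr_ge0 // exprn_gt0.
have D (y : R) : is_derive y (1 : R) (fun y => atan (y / d) / d) ((y ^+ 2 + d ^+ 2)^-1).
  have D1 := is_derive_mul (is_derive_id y (1 : R)) (is_derive_cst (d^-1 : R) y (1 : R)).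
  apply: is_derive_val (is_derive_mul (is_derive_comp (is_derive1_atan _) D1) (is_derive_cst (d^-1 : R) _ _)) _.
  rewrite /cst; have := gt_eqF (p0 y) => p1.
  have p2 : d ^+ 2 + y ^+ 2 != 0 by rewrite addrC p1.
  by field; rewrite ?dn0 ?p1 ?p2.
have N11 : (-1 : R) < 1 by lra.
rewrite (@FTC2 R _ _ _ _ N11 (fun y _ => D y)); last first.
  by move=> y _; exact: atan_cont.
rewrite lee_fin -mulrBl ler_wpM2r ?invr_ge0 ?(ltW d0) //.
have := atan_ltpi2 (1 / d); have := atan_gtNpi2 (-1 / d); have := @pihalf_lt2 R; lra.
Qed.

Lemma square_x (o : R) (x : R) : o = 1 \/ o = -1 -> -1 <= x <= 1 -> 0 <= 1 - o * x <= 2.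
Proof. by move=> [] -> /andP[? ?]; apply/andP; split; lra. Qed.

(* The disk lies in the parabola |1 - o z|^2 <= 2 (1 - o x), so that the logarithm may
   be frozen in y before integrating in y. *)
Lemma disk_sig_le o z : o = 1 \/ o = -1 -> disk R z -> sig o z <= 2%:R * (1 - o * z.1).
Proof. by rewrite /disk /sig /=; move=> [] -> ?; nra. Qed.

(** Once the logarithm is frozen at [lam x], the integral in y is of arctangent type and at most 4/d
    with d^2 = (1-ox)^2 + e; what remains is dominated by the derivative of [N], a bounded multiple
    of ell^(-1/4). The bound does not depend on e: it serves for e -> 0 to integrate the weight
    [wgt], and for e > 0 to bound the energy of the regularized test functions. *)
Lemma K_bound (o e : R) : o = 1 \/ o = -1 -> 0 < e <= 1 ->
  (\int[lebesgue2]_(z in disk R) (Kf o e z)%:E <= (288%:R)%:E)%E.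
Proof.
move=> o1 /andP[e0 e1].
pose lam (x : R) := ell (2%:R * (1 - o * x) + e).
pose G z := (r4 (lam z.1) ^+ 5 * (z.2 ^+ 2 + ((1 - o * z.1) ^+ 2 + e)))^-1.
pose N x := - (4%:R * o) / r4 (lam x).
pose q (x : R) := 2%:R * (1 - o * x) + e.
pose N' x := 2%:R / (r4 (lam x) ^+ 5 * (q x * (q x + 1))).
(* An open neighbourhood of the closed square on which q > e/2, so that [smooth_on] and the
   measurability it implies are available up to the sides. *)
pose Om := [set z : R * R | - e / 2 < 2%:R * (1 - o * z.1)].
have oOm : open Om.
  apply: (@open_comp _ _ (fun z : R * R => 2%:R * (1 - o * z.1)) [set x | - e / 2 < x]); last exact: open_gt.
  move=> z _; apply: (@sm_continuous _ setT (fun z => 2%:R * (1 - o * z.1))) => //.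
  apply: sm_mul; first exact: sm_cst.
  apply: sm_sub; first exact: sm_cst.
  by apply: sm_mul; [exact: sm_cst|exact: sm_fst].
have q0 z : Om z -> 0 < q z.1 by rewrite /Om /q /=; lra.
have sOm : square `<=` Om.
  by move=> z [/=]; rewrite in_itv /= => /(square_x o1) /andP[H _] _; rewrite /Om /=; lra.
have den0 z : 0 < z.2 ^+ 2 + ((1 - o * z.1) ^+ 2 + e).
  by rewrite ltr_wpDl ?sqr_ge0 // ltr_wpDl ?sqr_ge0.
have sq : smooth_on Om (fun z => q z.1).
  apply: sm_add; last exact: sm_cst.
  apply: sm_mul; first exact: sm_cst.
  apply: sm_sub; first exact: sm_cst.
  by apply: sm_mul; [exact: sm_cst|exact: sm_fst].
have slam : smooth_on Om (fun z => r4 (lam z.1) ^+ 5).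
  apply: sm_pow; apply: sm_r4; first by move=> z /q0 /ltW; exact: ell_gt0.
  exact: sm_ell.
have sG : smooth_on Om G.
  apply: sm_inv; first by move=> z _; rewrite mulf_neq0 ?expf_neq0 ?gt_eqF ?r4_gt0 ?den0.
  apply: sm_mul => //; apply: sm_add; first by apply: sm_pow; exact: sm_snd.
  apply: sm_add; last exact: sm_cst.
  apply: sm_pow; apply: sm_sub; first exact: sm_cst.
  by apply: sm_mul; [exact: sm_cst|exact: sm_fst].
have G0 z : 0 <= G z.
  by rewrite invr_ge0 mulr_ge0 ?exprn_ge0 ?(ltW (r4_gt0 _)) // ltW // den0.
have mG : measurable_fun (square : set R2) (EFin \o G).
  apply/measurable_EFinP; apply: measurable_funS (sm_measurable oOm sG) => //.
  by apply: open_measurable2; exact: oOm.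
have sN' : smooth_on Om (fun z => N' z.1).
  apply: sm_mul; first exact: sm_cst.
  apply: sm_inv.
    move=> z /q0 qz; rewrite mulf_neq0 ?expf_neq0 ?gt_eqF ?r4_gt0 //.
    by rewrite mulr_gt0 // addr_gt0.
  apply: sm_mul => //; apply: sm_mul => //; apply: sm_add => //; exact: sm_cst.
have xOm (x : R) : -1 <= x <= 1 -> Om (x, 0).
  by move=> xI; apply: sOm; split; rewrite /= in_itv //=; lra.
have dN (x : R) : -1 <= x <= 1 -> is_derive x (1 : R) N (N' x).
  move=> /xOm /q0 /= qx; have lx : 0 < lam x by apply: ell_gt0; exact: ltW.
  have rx : r4 (lam x) != 0 by rewrite gt_eqF ?r4_gt0.
  have D1 : is_derive x (1 : R) q (- (2%:R * o)).
    apply: is_derive_val (is_derive_add (is_derive_mul (is_derive_cst (2%:R : R) x 1)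
       (is_derive_add (is_derive_cst (1 : R) x 1) (is_derive_opp (is_derive_mul (is_derive_cst (o : R) x 1) (is_derive_id x (1 : R))))))
       (is_derive_cst (e : R) x 1)) _.
    by rewrite /cst; ring.
  have D2 := @is_derive_comp R R ell q x 1 _ _ (is_derive_ell qx) D1.
  have D3 := @is_derive_comp R R r4 lam x 1 _ _ (is_derive_r4 lx) D2.
  have D4 := is_derive_mul (is_derive_cst (- (4%:R * o) : R) x 1) (@is_derive_inv R R (fun x => r4 (lam x)) x 1 _ rx D3).
  apply: is_derive_val D4 _; rewrite /cst /N'.
  have qn0 : q x != 0 by rewrite gt_eqF.
  have q1n0 : q x + 1 != 0 by rewrite gt_eqF // addr_gt0.
  transitivity (o ^+ 2 * 2%:R / (r4 (lam x) ^+ 5 * (q x * (q x + 1)))); first by field; rewrite rx qn0 q1n0.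
  by case: o1 => ->; rewrite ?sqrrN expr1n mul1r.
have cN' (x : R) : -1 <= x <= 1 -> {for x, continuous N'}.
  move=> /xOm Ox; have [g _ dg] := sm_partial false sN'.
  by apply: is_derive1_continuous; apply: (is_derive_slice1 (dg _ Ox)).
have N'0 (x : R) : -1 <= x <= 1 -> 0 <= N' x.
  move=> /xOm /q0 /= qx; rewrite divr_ge0 // mulr_ge0 ?exprn_ge0 ?(ltW (r4_gt0 _)) //.
  by rewrite mulr_ge0 ?(ltW qx) // addr_ge0 // ltW.
have N11 : (-1 : R) < 1 by lra.
have INn : (\int[mu]_(x in I11) (N' x)%:E = (N 1 - N (-1))%:E)%E.
  by apply: FTC2.
have N8 : N 1 - N (-1) <= 8%:R.
  have B (x : R) : -1 <= x <= 1 -> 0 <= (r4 (lam x))^-1 <= 1.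
    move=> /xOm /q0 /= qx; rewrite invr_ge0 (ltW (r4_gt0 _)) /= invf_le1 ?r4_gt0 //.
    by rewrite r4_ge1 // ell_ge1 // ltW.
  have /andP[a1 b1] := B 1 ltac:(by lra).
  have /andP[a2 b2] := B (-1) ltac:(by lra).
  by rewrite /N; case: o1 => -> ; lra.
apply: (@le_trans _ _ (\int[lebesgue2]_(z in disk R) (G z)%:E)%E).
  apply: ge0_le_integral.
  - exact: disk_measurable.
  - by move=> z _; rewrite lee_fin Kf_ge0 // ltW.
  - apply/measurable_EFinP; apply: sm_measurable; first exact: disk_open.
    by apply: sm_Kf => [|z _]; [exact: ltW|rewrite ltr_wpDl ?sig_ge0].
  - by apply: measurable_funS mG; [exact: square_measurable|exact: disk_square].
  - move=> z Dz; rewrite lee_fin /G /Kf.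
    have E : z.2 ^+ 2 + ((1 - o * z.1) ^+ 2 + e) = sig o z + e by rewrite /sig; ring.
    have S0 : 0 < sig o z + e by rewrite -E.
    rewrite E lef_pV2 ?posrE ?mulr_gt0 ?exprn_gt0 ?r4_gt0 //.
    rewrite ler_wpM2r ?(ltW S0) // lerXn2r ?nnegrE ?(ltW (r4_gt0 _)) //.
    apply: r4_le; first by apply: ell_gt0; apply/ltW/q0/sOm/disk_square.
    by apply: ell_anti => //; rewrite lerD2r disk_sig_le.
apply: (@le_trans _ _ (\int[lebesgue2]_(z in square) (G z)%:E)%E).
  apply: ge0_subset_integral => //.
  - exact: disk_measurable.
  - exact: square_measurable.
  - by move=> z _; rewrite lee_fin.
  - exact: disk_square.
(* The factor 36 is what turns 4/d into a bound by [N']: q (q+1) <= 3 d * 6 gives 4/d <= 36 * 2/(q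
   (q+1)). With [N8] the total is 36 * 8 = 288. *)
apply: (@le_trans _ _ (\int[mu]_(x in I11) ((36%:R)%:E * (N' x)%:E))%E).
  apply: square_tonelli_le => //.
  - by move=> z _; rewrite lee_fin.
  - apply: measurable_funeM; apply/measurable_EFinP.
    exact: itv_measurable.
  - move=> x xI; have Ox := xOm x xI; have qx := q0 _ Ox; rewrite /= in qx.
    set d := Num.sqrt ((1 - o * x) ^+ 2 + e).
    have p0 : 0 < (1 - o * x) ^+ 2 + e by rewrite ltr_wpDl ?sqr_ge0.
    have d0 : 0 < d by rewrite sqrtr_gt0.
    have d2 : d ^+ 2 = (1 - o * x) ^+ 2 + e by rewrite sqr_sqrtr // ltW.
    have c0 : 0 <= (r4 (lam x) ^+ 5)^-1 by rewrite invr_ge0 exprn_ge0 // ltW // r4_gt0.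
    have -> : (\int[mu]_(y in I11) (G (x, y))%:E =
       ((r4 (lam x) ^+ 5)^-1)%:E * \int[mu]_(y in I11) ((y ^+ 2 + d ^+ 2)^-1)%:E)%E.
      rewrite -ge0_integralZl_EFin //; last 2 first.
      + by move=> y _; rewrite lee_fin invr_ge0 addr_ge0 ?sqr_ge0.
      + apply/measurable_EFinP; apply: itv_measurable => y _; exact: atan_cont.
      by apply: eq_integral => y _; rewrite -EFinM /G /= -d2 invfM.
    apply: (le_trans (lee_wpmul2l _ (atan_int d0))); first by rewrite lee_fin.
    rewrite -!EFinM lee_fin /N' [X in _ <= _ * (_ * X)]invfM.
    rewrite [X in _ <= _ * X]mulrCA [X in _ <= X]mulrCA; apply: ler_wpM2l => //.
    have /andP[xi0 xi2] := square_x o1 xI.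
    have q6 : q x + 1 <= 6%:R by rewrite /q; lra.
    (* Here 2(1-ox) <= 2d, and e <= sqrt e <= d because e <= 1. *)
    have qd : q x <= 3%:R * d.
      rewrite -(@ler_pXn2r R 2) ?nnegrE ?(ltW qx) ?mulr_ge0 ?(ltW d0) //.
      rewrite exprMn d2 /q; nra.
    have qn0 : q x != 0 by rewrite gt_eqF.
    have q1n0 : q x + 1 != 0 by rewrite gt_eqF // addr_gt0.
    rewrite ler_pdivrMr //.
    have -> : 36%:R * (2%:R / (q x * (q x + 1))) * d = 72%:R * d / (q x * (q x + 1)).
      by field; rewrite q1n0 qn0.
    rewrite ler_pdivlMr; last by apply: mulr_gt0 => //; rewrite addr_gt0.
    have : q x * (q x + 1) <= 3%:R * d * 6%:R by apply: ler_pM => //; [exact: ltW|apply: addr_ge0 => //; exact: ltW].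
    lra.
have mN' : measurable_fun I11 (fun x => (N' x)%:E).
  by apply/measurable_EFinP; exact: itv_measurable.
have N'0' (x : R) : I11 x -> (0 <= (N' x)%:E)%E.
  by rewrite /= in_itv /= lee_fin; exact: N'0.
have I36 : (0 : R) <= 36%:R by [].
rewrite (ge0_integralZl_EFin mu (measurable_itv _) N'0' mN' I36).
rewrite INn -EFinM lee_fin; lra.
Qed.

(** Fatou along e = 1/(n+1), since [K_bound] is uniform in e. *)
Lemma Kf0_bound (o : R) : o = 1 \/ o = -1 ->
  (\int[lebesgue2]_(z in disk R) (Kf o 0 z)%:E <= (288%:R)%:E)%E.
Proof.
move=> o1.
have sig0 z : disk R z -> 0 < sig o z.
  by rewrite /sig; case: o1 => -> Dz; have := sA_gt0 Dz; have := sB_gt0 Dz; rewrite /sA /sB; lra.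
pose f (n : nat) z := (Kf o n.+1%:R^-1 z)%:E.
have mf n : measurable_fun (disk R : set R2) (f n).
  apply/measurable_EFinP; apply: sm_measurable; first exact: disk_open.
  by apply: sm_Kf => // z /sig0 sz; rewrite addr_gt0.
have f0 n z : disk R z -> (0 <= f n z)%E by move=> _; rewrite lee_fin Kf_ge0.
have cf z : disk R z -> f ^~ z @ \oo --> (Kf o 0 z)%:E.
  move=> /sig0 sz; apply: cvg_EFin; first by apply: nearW.
  have H : {for 0, continuous (fun e : R => Kf o e z)}.
    have D1 := is_derive_add (is_derive_cst (sig o z : R) (0 : R) 1) (is_derive_id (0 : R) (1 : R)).
    have s0 : 0 < sig o z + 0 by rewrite addr0.
    have D2 := @is_derive_comp R R ell (fun e : R => sig o z + e) 0 1 _ _ (is_derive_ell s0) D1.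
    have l0 : 0 < ell (sig o z + 0) by rewrite addr0 ell_gt0 // ltW.
    have D3 := @is_derive_comp R R r4 (fun e : R => ell (sig o z + e)) 0 1 _ _ (is_derive_r4 l0) D2.
    have D4 := is_derive_mul (is_derive_exp 5 D3) D1.
    have n0 : r4 (ell (sig o z + 0)) ^+ 5 * (sig o z + 0) != 0.
      by rewrite mulf_neq0 ?expf_neq0 ?gt_eqF ?r4_gt0 // addr0.
    have D5 := @is_derive_inv R R (fun e : R => r4 (ell (sig o z + e)) ^+ 5 * (sig o z + e)) 0 1 _ n0 D4.
    exact: (is_derive1_continuous D5).
  apply: (@cvg_comp _ _ _ (fun n : nat => n.+1%:R^-1 : R) (fun e : R => Kf o e z)); last exact: H.
  exact: cvg_harmonic.
have := fatou lebesgue2 disk_measurable mf f0.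
rewrite (@eq_integral _ _ _ lebesgue2 (disk R) (fun z => (Kf o 0 z)%:E)); last first.
  move=> z /set_mem Dz; rewrite is_cvg_limn_einfE; first by apply: cvg_lim => //; exact: cf.
  by apply/cvg_ex; eexists; exact: cf.
move/le_trans; apply.
rewrite limn_einf_lim; apply: lime_le; first exact: is_cvg_einfs.
apply: nearW => n; apply: (@le_trans _ _ (\int[lebesgue2]_(z in disk R) f n z)%E).
  by apply: ereal_inf_lbound; exists n => //=.
by apply: K_bound => //; rewrite invr_gt0 ltr0n /= invf_le1 ?ler1n.
Qed.

(** The density (1+t^2)^(-5/8) dt dtheta of the strip pulled back to the disk. Up to constants it is
    the common integrable majorant of the energy densities of a and b, of the Jacobian, of phi and
    of its gradient. *)
Definition wgt z : R := (Wt (tz z) ^+ 10)^-1 * gt2 z.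

Lemma WtN s : Wt (- s) = Wt s. Proof. by rewrite /Wt sqrrN. Qed.

Lemma ln_le (x : R) : 0 < x -> ln x <= x - 1.
Proof.
move=> x0; have H : -1 < x - 1 by lra.
by have := le_ln1Dx H; rewrite (_ : 1 + (x - 1) = x) //; ring.
Qed.

Lemma disk_AB z : disk R z -> [/\ sA z <= 4%:R, sB z <= 4%:R & (1 <= sA z) || (1 <= sB z)].
Proof.
rewrite /disk /sA /sB /= => Dz; split; [nra|nra|].
have [x0|x0] := leP 0 z.1; apply/orP; [left|right]; have := sqr_ge0 z.2; nra.
Qed.

(** In the application p and q are the squared distances to the two singularities, q being one that
    is at least 1. Then -ln p <= 2t, so ell p <= 5 + 2|t| and its square is at most 50 (1+t^2); the
    power 5/8 of this comparison is the claim. *)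
Lemma Wt_ell (p q : R) : 0 < p <= 4%:R -> 1 <= q ->
  (Wt ((ln q - ln p) / 2%:R) ^+ 10)^-1 <= 1024%:R / r4 (ell p) ^+ 5.
Proof.
move=> /andP[p0 p4] q1; set t := (ln q - ln p) / 2%:R; have W0 := Wt_gt0 t; have q0 : 0 < q by lra.
have k0 := r4_gt0 (ell p); have l1 := ell_ge1 (ltW p0); have l0 := ell_gt0 (ltW p0).
have Hl : ell p <= 5%:R + 2%:R * `|t|.
  have -> : ell p = 1 + (ln (1 + p) - ln p).
    rewrite /ell -ln_div ?posrE ?addr_gt0 //; congr (1 + ln _).
    by field; rewrite gt_eqF.
  have := @le_ln1Dx R p ltac:(by lra); have := ln_ge0 q1; have := ler_norm t; have : 2%:R * t = ln q - ln p by rewrite /t; field.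
  lra.
have H : r4 (ell p) ^+ 8 <= 50%:R * Wt t ^+ 16.
  rewrite (exprM _ 4 2) r4K // Wt16.
  have := normr_ge0 t; have : `|t| ^+ 2 = t ^+ 2 by rewrite real_normK ?num_real.
  by have := sqr_ge0 (`|t| - 5%:R / 2%:R); nra.
have H2 : r4 (ell p) <= 2%:R * Wt t ^+ 2.
  rewrite -(@ler_pXn2r R 8) ?nnegrE ?(ltW k0) ?mulr_ge0 ?exprn_ge0 ?(ltW W0) //.
  rewrite exprMn -exprM (le_trans H) // ler_wpM2r ?exprn_ge0 ?(ltW W0) //.
  by rewrite -natrX ler_nat.
rewrite ler_pdivlMr ?exprn_gt0 // mulrC ler_pdivrMr ?exprn_gt0 //.
have : r4 (ell p) ^+ 5 <= (2%:R * Wt t ^+ 2) ^+ 5.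
  by rewrite lerXn2r ?nnegrE ?(ltW k0) ?mulr_ge0 ?exprn_ge0 ?(ltW W0).
rewrite exprMn -exprM -natrX => /le_trans; apply.
by rewrite ler_wpM2r ?exprn_ge0 ?(ltW W0) // ler_nat.
Qed.

Lemma wgt_ge0 z : disk R z -> 0 <= wgt z.
Proof.
move=> Dz; rewrite mulr_ge0 ?invr_ge0 ?exprn_ge0 ?(ltW (Wt_gt0 _)) //.
by rewrite divr_ge0 // mulr_ge0 ?(ltW (sA_gt0 Dz)) ?(ltW (sB_gt0 Dz)).
Qed.

Lemma tz_swap z : (ln (sB z) - ln (sA z)) / 2%:R = - tz z.
Proof. by rewrite /tz -mulNr opprB. Qed.

Lemma wgt_le z : disk R z -> wgt z <= 4096%:R * (Kf 1 0 z + Kf (-1) 0 z).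
Proof.
move=> Dz; have A0 := sA_gt0 Dz; have B0 := sB_gt0 Dz; have [A4 B4 AB1] := disk_AB Dz.
have KB : Kf 1 0 z = (r4 (ell (sB z)) ^+ 5)^-1 / sB z.
  have E : sig 1 z = sB z by rewrite /sig mul1r.
  by rewrite /Kf addr0 E invfM.
have KA : Kf (-1) 0 z = (r4 (ell (sA z)) ^+ 5)^-1 / sA z.
  have E : sig (-1) z = sA z by rewrite /sig mulN1r opprK.
  by rewrite /Kf addr0 E invfM.
have W0 : 0 <= (Wt (tz z) ^+ 10)^-1 by rewrite invr_ge0 exprn_ge0 // ltW // Wt_gt0.
have K1 : 0 <= Kf 1 0 z by exact: Kf_ge0.
have K2 : 0 <= Kf (-1) 0 z by exact: Kf_ge0.
rewrite /wgt /gt2; case/orP: AB1 => [A1|B1].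
  apply: (@le_trans _ _ (4096%:R * Kf 1 0 z)); last by lra.
  have := @Wt_ell (sB z) (sA z) ltac:(by rewrite B0 B4) A1; rewrite -/(tz z) => H.
  rewrite KB; apply: (@le_trans _ _ ((Wt (tz z) ^+ 10)^-1 * (4%:R / sB z))).
    apply: ler_wpM2l => //; apply: ler_wpM2l => //.
    by rewrite lef_pV2 ?posrE ?mulr_gt0 //; nra.
  have iB : 0 <= (sB z)^-1 by rewrite invr_ge0 ltW.
  by rewrite mulrA mulrA; apply: ler_wpM2r => //; lra.
apply: (@le_trans _ _ (4096%:R * Kf (-1) 0 z)); last by lra.
have := @Wt_ell (sA z) (sB z) ltac:(by rewrite A0 A4) B1; rewrite tz_swap WtN => H.
rewrite KA; apply: (@le_trans _ _ ((Wt (tz z) ^+ 10)^-1 * (4%:R / sA z))).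
  apply: ler_wpM2l => //; apply: ler_wpM2l => //.
  by rewrite lef_pV2 ?posrE ?mulr_gt0 //; nra.
have iA : 0 <= (sA z)^-1 by rewrite invr_ge0 ltW.
by rewrite mulrA mulrA; apply: ler_wpM2r => //; lra.
Qed.

Lemma sm_sA Om : smooth_on Om (@sA R).
Proof.
apply: sm_add; apply: sm_pow; last exact: sm_snd.
by apply: sm_add; [exact: sm_cst|exact: sm_fst].
Qed.

Lemma sm_sB Om : smooth_on Om (@sB R).
Proof.
apply: sm_add; apply: sm_pow; last exact: sm_snd.
by apply: sm_sub; [exact: sm_cst|exact: sm_fst].
Qed.

Lemma sm_dsk Om : smooth_on Om (@dsk R).
Proof.
apply: sm_sub; last by apply: sm_pow; exact: sm_snd.
apply: sm_sub; first exact: sm_cst.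
by apply: sm_pow; exact: sm_fst.
Qed.

Lemma sm_tz : smooth_on (disk R) (@tz R).
Proof.
apply: sm_mul; last exact: sm_cst.
apply: sm_sub; apply: sm_ln; [exact: sA_gt0|exact: sm_sA|exact: sB_gt0|exact: sm_sB].
Qed.

Lemma sm_Wt Om f : smooth_on Om f -> smooth_on Om (fun z => Wt (f z)).
Proof.
move=> sf; apply: sm_exp; apply: sm_mul; last exact: sm_cst.
apply: sm_ln; first by move=> z _; exact: sqr1_gt0.
by apply: sm_add; [exact: sm_cst|exact: sm_pow].
Qed.

Lemma sm_invWt Om k f : smooth_on Om f -> smooth_on Om (fun z => (Wt (f z) ^+ k)^-1).
Proof.
move=> sf; apply: sm_inv; first by move=> z _; rewrite expf_neq0 // Wt_neq0.
by apply: sm_pow; exact: sm_Wt.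
Qed.

Lemma sm_invAB : smooth_on (disk R) (fun z => (sA z * sB z)^-1).
Proof.
apply: sm_inv; last by apply: sm_mul; [exact: sm_sA|exact: sm_sB].
by move=> z Dz; rewrite mulf_neq0 // gt_eqF // ?sA_gt0 ?sB_gt0.
Qed.

Lemma sm_gt2 : smooth_on (disk R) (@gt2 R).
Proof. by apply: sm_mul; [exact: sm_cst|exact: sm_invAB]. Qed.

Lemma sm_wgt : smooth_on (disk R) wgt.
Proof. by apply: sm_mul; [apply: sm_invWt; exact: sm_tz|exact: sm_gt2]. Qed.

Lemma Kf0_integrable o : o = 1 \/ o = -1 ->
  lebesgue2.-integrable (disk R) (EFin \o Kf o 0).
Proof.
move=> o1; have sig0 z : disk R z -> 0 < sig o z.
  by rewrite /sig; case: o1 => -> Dz; have := sA_gt0 Dz; have := sB_gt0 Dz; rewrite /sA /sB; lra.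
apply/integrableP; split.
  apply/measurable_EFinP; apply: sm_measurable; first exact: disk_open.
  by apply: sm_Kf => // z /sig0; rewrite addr0.
apply: le_lt_trans (ltry 288%:R); apply: le_trans (Kf0_bound o1).
by under eq_integral => z _ do rewrite /= ger0_norm ?Kf_ge0 //.
Qed.

Lemma sm_integrable f (c : R) (h : R * R -> R) : smooth_on (disk R) f ->
  lebesgue2.-integrable (disk R) (EFin \o h) ->
  (forall z, disk R z -> `|f z| <= c * h z) ->
  lebesgue2.-integrable (disk R) (EFin \o f).
Proof.
move=> sf ih fh.
apply: (@le_integrable _ _ _ lebesgue2 _ disk_measurable _ (EFin \o (fun z => c * h z))).
- by apply/measurable_EFinP; apply: sm_measurable => //; exact: disk_open.
- by move=> z Dz; rewrite /= lee_fin (le_trans (fh z Dz)) // ler_norm.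
- exact: (integrableZl disk_measurable c ih).
Qed.

Lemma wgt_integrable : lebesgue2.-integrable (disk R) (EFin \o wgt).
Proof.
apply: (@sm_integrable wgt 4096%:R (fun z => Kf 1 0 z + Kf (-1) 0 z)).
- exact: sm_wgt.
- have H := integrableD disk_measurable (Kf0_integrable (or_introl erefl)) (Kf0_integrable (or_intror erefl)).
  exact: H.
- by move=> z Dz; rewrite ger0_norm ?wgt_ge0 // wgt_le.
Qed.

(** The larger of [sA z], [sB z] is at most 4 and exceeds the other by the factor exp(2|t|), so the
    product is at most 16 exp(-2|t|), whereas (1+t^2)^2 <= 16 exp(2|t|). *)
Lemma key_AB z : disk R z -> (1 + tz z ^+ 2) ^+ 2 * (sA z * sB z) <= 256%:R.
Proof.
suff H (p q : R) : 0 < p -> 0 < q -> p <= q -> q <= 4%:R ->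
    (1 + ((ln q - ln p) / 2%:R) ^+ 2) ^+ 2 * (q * p) <= 256%:R.
  move=> Dz; have A0 := sA_gt0 Dz; have B0 := sB_gt0 Dz; have [A4 B4 _] := disk_AB Dz.
  have [BA|/ltW AB] := leP (sB z) (sA z); first exact: H.
  by have := H _ _ A0 B0 AB B4; rewrite tz_swap sqrrN [sB z * _]mulrC.
move=> p0 q0 pq q4; set t := (ln q - ln p) / 2%:R.
have t0 : 0 <= t by rewrite divr_ge0 // subr_ge0 ler_ln ?posrE.
have E : expR t ^+ 2 = q / p.
  by rewrite -expRM_natl /t mulrC divfK ?pnatr_eq0 // -ln_div ?posrE // lnK ?posrE ?divr_gt0.
have T : 1 + t ^+ 2 <= 4%:R * expR t.
  have -> : expR t = expR (t / 2%:R) ^+ 2 by rewrite -expRM_natl mulrC divfK ?pnatr_eq0.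
  have := expR_ge1Dx (t / 2%:R); nra.
have T2 : (1 + t ^+ 2) ^+ 2 <= 16%:R * (q / p).
  rewrite -E; have := sqr_ge0 t; have := expR_gt0 t; nra.
apply: (@le_trans _ _ (16%:R * (q / p) * (q * p))).
  by rewrite ler_wpM2r // mulr_ge0 // ltW.
have -> : 16%:R * (q / p) * (q * p) = 16%:R * q ^+ 2 by field; rewrite gt_eqF.
nra.
Qed.

(** Since [gt2] grows exponentially in |t| by [key_AB], losing a power of [Wt] is affordable: [wgt],
    quadratic in the gradient of t, also dominates this gradient to the first power. *)
Lemma le_wgt z (p : R) : disk R z -> p ^+ 2 <= gt2 z -> p <= 8%:R * wgt z.
Proof.
move=> Dz pg; have A0 := sA_gt0 Dz; have B0 := sB_gt0 Dz; have N0 := mulr_gt0 A0 B0.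
have [p0|/ltW p0] := leP p 0; first by rewrite (le_trans p0) // mulr_ge0 ?wgt_ge0.
suff H : p ^+ 2 <= (8%:R * wgt z) ^+ 2.
  by move: H; rewrite ler_pXn2r // nnegrE // mulr_ge0 // wgt_ge0.
apply: (le_trans pg).
have W0 := Wt_gt0 (tz z); have := key_AB Dz; rewrite -Wt16 -exprM => K.
have K2 : Wt (tz z) ^+ 20 * (sA z * sB z) <= 256%:R.
  apply: le_trans K; apply: ler_wpM2r; first exact: ltW.
  by apply: ler_weXn2l => //; exact: Wt_ge1.
rewrite /wgt exprMn exprMn exprVn -exprM /gt2 ler_pdivrMr //.
set W20 := _ ^+ 20 in K2 *; have W20p : 0 < W20 by rewrite exprn_gt0.
have -> : 8%:R ^+ 2 * (W20^-1 * (4%:R / (sA z * sB z)) ^+ 2) * (sA z * sB z) =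
   1024%:R / (W20 * (sA z * sB z)) by field; rewrite !gt_eqF.
by rewrite ler_pdivlMr ?mulr_gt0 //; lra.
Qed.

Lemma tz_le_wgt z : disk R z -> `|tz z| <= 64%:R * wgt z.
Proof.
move=> Dz; have A0 := sA_gt0 Dz; have B0 := sB_gt0 Dz; have N0 := mulr_gt0 A0 B0.
suff /(le_wgt Dz) : (`|tz z| / 8%:R) ^+ 2 <= gt2 z by lra.
rewrite /gt2 ler_pdivlMr // expr_div_n real_normK ?num_real //.
have := key_AB Dz; have := sqr_ge0 (tz z); set T := tz z ^+ 2; set N := sA z * sB z in N0 *.
move=> T0 H; have : T * N <= 256%:R by apply: le_trans H; rewrite ler_wpM2r ?(ltW N0) //; nra.
have -> : T / 8%:R ^+ 2 * N = T * N / 64%:R by field.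
by rewrite ler_pdivrMr //; lra.
Qed.

(** From [sAB], sA sB >= dsk^2, while each of ln sA, ln sB is at most 3. This links the distance to
    the circle, which governs the cut-off, to t, which governs the decay. *)
Lemma tz_le_dsk z : disk R z -> `|tz z| <= - ln (dsk z) + 3%:R.
Proof.
move=> Dz; have A0 := sA_gt0 Dz; have B0 := sB_gt0 Dz; have d0 := dsk_gt0 Dz.
have [A4 B4 _] := disk_AB Dz.
have L : ln (dsk z) + ln (dsk z) <= ln (sA z) + ln (sB z).
  rewrite -!lnM ?posrE // ler_ln ?posrE ?mulr_gt0 //.
  by rewrite sAB -expr2 lerDl sqr_ge0.
have := ln_le A0; have := ln_le B0; rewrite /tz ler_norml => ? ?.
by apply/andP; split; lra.
Qed.

End Integrability.

(** * Cut-off functions and dominated convergence *)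

Section Cutoff.
Context {R : realType}.
Local Notation Rm := (measurableTypeR R).
Local Notation R2 := (measurableTypeR R * measurableTypeR R)%type.
Local Notation D := (disk R : set R2).
Implicit Types (s e : R) (z : R * R) (i : bool) (f g u v : R * R -> R).

(** * Lebesgue spaces on the disk *)

Lemma Lp_measurable (p : \bar R) f : Lp (disk R) p f -> measurable_fun D f.
Proof.
rewrite /Lp inE => /andP[+ _]; rewrite inE /= => mf.
exact: (measurable_restrictT f disk_measurable).2.
Qed.

Lemma Lp1P f : Lp (disk R) 1%:E f <-> lebesgue2.-integrable D (EFin \o f).
Proof.
rewrite /Lp Lfun1_integrable -restrict_EFin.
exact: iff_sym (integrable_mkcond _ disk_measurable).
Qed.

Lemma Lp2_sqr_integrable f : Lp (disk R) 2%:E f ->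
  lebesgue2.-integrable D (EFin \o (fun z => f z ^+ 2)).
Proof.
move=> /Lfun2_integrable_sqr H; apply/(integrable_mkcond _ disk_measurable).2.
apply: eq_integrable H => // z _; rewrite /= !patchE.
by case: ifP => // _; rewrite expr0n.
Qed.

Lemma sqr_integrable_Lp2 f : measurable_fun D f ->
  lebesgue2.-integrable D (EFin \o (fun z => f z ^+ 2)) -> Lp (disk R) 2%:E f.
Proof.
move=> mf If; rewrite /Lp inE; apply/andP; split; rewrite inE /=.
  exact: (measurable_restrictT f disk_measurable).1.
rewrite /finite_norm unlock; apply: poweR_lty.
have /integrableP[_] := (integrable_mkcond _ disk_measurable).1 If.
apply: le_lt_trans; rewrite le_eqVlt; apply/orP; left; apply/eqP.
apply: eq_integral => z _; rewrite /= !patchE; case: ifP => _ /=.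
  by rewrite normrX -powR_mulrn.
by rewrite normr0 powR0 // pnatr_eq0.
Qed.

Lemma bounded_Lpy f (M : R) : measurable_fun D f ->
  (forall z, disk R z -> `|f z| <= M) -> Lp (disk R) +oo%E f.
Proof.
move=> mf fM; rewrite /Lp inE; apply/andP; split; rewrite inE /=.
  exact: (measurable_restrictT f disk_measurable).1.
rewrite /finite_norm unlock; case: ifP => // _.
apply: le_lt_trans (ltry (Num.max M 0)); apply/ess_supP.
apply: aeW => z /=; rewrite lee_fin patchE; case: ifPn => [/set_mem Dz|_].
  by rewrite le_max fM.
by rewrite normr0 le_max lexx orbT.
Qed.

(** The disk has finite measure and |f| <= 1 + f^2. *)
Lemma Lp2_Lp1 f : Lp (disk R) 2%:E f -> lebesgue2.-integrable D (EFin \o f).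
Proof.
move=> L2; have mf := Lp_measurable L2; have If := Lp2_sqr_integrable L2.
have I1 : lebesgue2.-integrable D (EFin \o (fun=> 1 : R)).
  apply: measurable_bounded_integrable; [exact: disk_measurable|exact: disk_lty|exact: measurable_cst|].
  by exists 1; split; rewrite ?num_real // => M M1 z _ /=; rewrite normr1 ltW.
have I2 := integrableD disk_measurable I1 If.
apply: le_integrable I2; first exact: disk_measurable.
- exact/measurable_EFinP.
- move=> z _; rewrite /= lee_fin [leRHS]ger0_norm; last by rewrite addr_ge0 // sqr_ge0.
  have := sqr_ge0 (`|f z| - 1); have : `|f z| ^+ 2 = f z ^+ 2 by rewrite real_normK ?num_real.
  have := normr_ge0 (f z); nra.
Qed.

Lemma dct_zero (h : nat -> R * R -> R) (l w : R * R -> R) :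
  (forall n, measurable_fun D (h n)) -> measurable_fun D l ->
  (forall z, disk R z -> h ^~ z @ \oo --> l z) ->
  (forall n z, disk R z -> `|h n z| <= w z) ->
  lebesgue2.-integrable D (EFin \o w) ->
  (forall n, \int[lebesgue2]_(z in D) h n z = 0) ->
  \int[lebesgue2]_(z in D) l z = 0.
Proof.
move=> mh ml hl hw Iw h0.
have [|||||Il _ C] := @dominated_convergence _ _ _ lebesgue2 D disk_measurable
  (fun n => EFin \o h n) (EFin \o l) (EFin \o w).
- by move=> n; exact/measurable_EFinP.
- exact/measurable_EFinP.
- by apply: aeW => z Dz; apply: cvg_EFin; [exact: nearW|exact: hl].
- exact: Iw.
- by apply: aeW => z n Dz; rewrite /= lee_fin hw.
(* A real-valued integral equal to 0 could also stand for an infinite one, by the default value of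
   [fine]; the majorant excludes this. *)
have E n : (\int[lebesgue2]_(z in D) (EFin \o h n) z = 0)%E.
  have Ih : lebesgue2.-integrable D (EFin \o h n).
    apply: le_integrable Iw; first exact: disk_measurable.
    - exact/measurable_EFinP.
    - by move=> z Dz; rewrite /= lee_fin (le_trans (hw n z Dz)) // ler_norm.
  by rewrite -[LHS]fineK; [have := h0 n; rewrite /Rintegral => ->|apply: integrable_fin_num => //; exact: disk_measurable].
rewrite /Rintegral.
have -> : (\int[lebesgue2]_(z in D) (l z)%:E = 0)%E.
  apply/esym; apply: cvg_unique C => //.
  rewrite (_ : (fun n : nat => _) = cst 0%E); first exact: cvg_cst.
  by apply/funext => n; exact: E.
by [].
Qed.

(* The cut-off is logarithmic in the distance to the circle and tends to exp(-1), not
   to 1. *)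
Definition zeta (n : nat) z : R := flat 0 (1 + ln (dsk z) / n.+1%:R).

Lemma sm_zeta n : smooth_on (disk R) (zeta n).
Proof.
apply: sm_flat; apply: sm_add; first exact: sm_cst.
apply: sm_mul; last exact: sm_cst.
by apply: sm_ln; [exact: dsk_gt0|exact: sm_dsk].
Qed.

Lemma is_derive_zeta n i z : disk R z -> is_derive z (dir i) (zeta n)
  (flat 2 (1 + ln (dsk z) / n.+1%:R) / n.+1%:R *
    (- (2%:R * (if i then z.2 else z.1)) / dsk z)).
Proof.
move=> Dz; have D1 := is_derive_comp (is_derive1_ln (dsk_gt0 Dz)) (is_derive_dsk i z).
have D2 := is_derive_add (is_derive_cst (1 : R) z (dir i)) (is_derive_mul D1 (is_derive_cst (n.+1%:R^-1 : R) _ _)).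
apply: is_derive_val (is_derive_comp (flat_is_derive 0 _) D2) _.
rewrite /cst mul0r subr0 mulr0 add0r add0r.
have d0 : dsk z != 0 by rewrite gt_eqF // dsk_gt0.
by field; rewrite d0 nat1r pnatr_eq0.
Qed.

Lemma test_zeta n v : smooth_on (disk R) v ->
  test_function (disk R) ((fun z => zeta n z * v z) \_ (disk R)).
Proof.
(* The argument of [flat 0] in [zeta n] is nonpositive as soon as dsk <= exp(-(n+1)), that is |z|^2
   >= r. *)
move=> sv; pose r : R := 1 - expR (- n.+1%:R).
apply: (@sm_test _ [set z : R * R | z.1 ^+ 2 + z.2 ^+ 2 <= r]).
- exact: closed_sqnorm_le.
- by move=> z /= /le_lt_trans; apply; rewrite /r ltrBlDr ltrDl expR_gt0.
- by apply: sm_mul => //; exact: sm_zeta.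
- move=> z Dz /negP; rewrite -ltNge /r => rz.
  rewrite /zeta flat_le0 ?mul0r //.
  have : ln (dsk z) <= - n.+1%:R.
    by rewrite -[leRHS]expRK ler_ln ?posrE ?expR_gt0 ?dsk_gt0 // /dsk; lra.
  move=> H; have n0 : 0 < n.+1%:R :> R by rewrite ltr0n.
  by rewrite -lerBrDl sub0r ler_pdivrMr // mulN1r.
Qed.

Lemma ln_dsk_le0 z : disk R z -> ln (dsk z) <= 0.
Proof.
move=> Dz; apply: ln_le0; rewrite /dsk; have := sqr_ge0 z.1; have := sqr_ge0 z.2; lra.
Qed.

Lemma flat0_le1 s : flat 0 s <= 1.
Proof.
rewrite /flat; case: ifP => // s0.
by rewrite expr0 mul1r -expR0 ler_expR oppr_le0 invr_ge0 ltW.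
Qed.

Lemma zeta_bound n z : 0 <= zeta n z <= 1.
Proof. by rewrite /zeta flat_ge0 flat0_le1. Qed.

Lemma zeta_cvg z : zeta ^~ z @ \oo --> (flat 0 1 : R).
Proof.
have Dc : is_derive (0 : R) 1 (fun e : R => 1 + ln (dsk z) * e) (ln (dsk z)).
  apply: is_derive_val (is_derive_add (is_derive_cst (1 : R) _ _) (is_derive_mul (is_derive_cst (ln (dsk z)) _ _) (is_derive_id _ _))) _.
  by rewrite /cst; ring.
have C := is_derive1_continuous (is_derive_comp (flat_is_derive 0 _) Dc).
have -> : (flat 0 1 : R) = (fun e : R => flat 0 (1 + ln (dsk z) * e)) 0 by rewrite mulr0 addr0.
apply: (@cvg_comp _ _ _ (fun n : nat => n.+1%:R^-1 : R) (fun e : R => flat 0 (1 + ln (dsk z) * e))); last exact: C.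
exact: cvg_harmonic.
Qed.

Lemma flat01_gt0 : 0 < flat 0 1 :> R.
Proof. by rewrite /flat ltr01 expr0 mul1r expR_gt0. Qed.

Lemma dzeta_cvg z : (fun n => flat 2 (1 + ln (dsk z) / n.+1%:R) / n.+1%:R) @ \oo --> (0 : R).
Proof.
have Dc : is_derive (0 : R) 1 (fun e : R => 1 + ln (dsk z) * e) (ln (dsk z)).
  apply: is_derive_val (is_derive_add (is_derive_cst (1 : R) _ _) (is_derive_mul (is_derive_cst (ln (dsk z)) _ _) (is_derive_id _ _))) _.
  by rewrite /cst; ring.
have C := is_derive1_continuous (is_derive_mul (is_derive_comp (flat_is_derive 2 _) Dc) (is_derive_id (0 : R) (1 : R))).
have E : (0 : R) = (fun e : R => flat 2 (1 + ln (dsk z) * e) * e) 0 by rewrite mulr0.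
rewrite [X in _ --> X]E.
apply: (@cvg_comp _ _ _ (fun n : nat => n.+1%:R^-1 : R) (fun e : R => flat 2 (1 + ln (dsk z) * e) * e)); last exact: C.
exact: cvg_harmonic.
Qed.

(* The cut-off costs 1/n only where -ln(1-|z|^2) <= n, hence where |t| <= n + 3. *)
Lemma dzeta_bound n z : disk R z ->
  0 <= flat 2 (1 + ln (dsk z) / n.+1%:R) / n.+1%:R <= 135%:R / Wt (tz z) ^+ 8.
Proof.
move=> Dz; have n0 : 0 < n.+1%:R :> R by rewrite ltr0n.
have W0 := Wt_gt0 (tz z).
rewrite divr_ge0 ?flat_ge0 ?(ltW n0) //=.
set s := 1 + _; have [s0|s0] := leP s 0.
  by rewrite flat_le0 // mul0r divr_ge0 // exprn_ge0 // ltW.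
have s1 : s <= 1 by rewrite /s gerDl pmulr_lle0 ?invr_gt0 // ln_dsk_le0.
(* [flat_le] with k = 2 gives 3^3 s, and s <= 1. The constant 135 is 27 * 5, the 5 coming from the
   bound on the eighth power of [Wt] below. *)
have F : flat 2 s <= 27%:R by apply: le_trans (flat_le 2 s0) _; rewrite -natrX; lra.
have U : - ln (dsk z) <= n.+1%:R.
  have : - (ln (dsk z) / n.+1%:R) <= 1 by move: s0; rewrite /s; set L := _ / _; lra.
  by rewrite -mulNr ler_pdivrMr // mul1r.
have T := tz_le_dsk Dz.
have T4 : `|tz z| <= 4%:R * n.+1%:R.
  have : 1 <= n.+1%:R :> R by rewrite ler1n.
  by move: U T; set N := n.+1%:R; lra.
have W8 : Wt (tz z) ^+ 8 <= 5%:R * n.+1%:R.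
  suff H : (Wt (tz z) ^+ 8) ^+ 2 <= (5%:R * n.+1%:R) ^+ 2.
    by move: H; rewrite ler_pXn2r // nnegrE ?exprn_ge0 ?(ltW W0) // mulr_ge0 // ltW.
  rewrite -exprM Wt16; have : `|tz z| ^+ 2 = tz z ^+ 2 by rewrite real_normK ?num_real.
  have : 1 <= n.+1%:R :> R by rewrite ler1n.
  have := normr_ge0 (tz z); nra.
rewrite ler_pdivrMr // mulrAC ler_pdivlMr ?exprn_gt0 //.
have : flat 2 s * Wt (tz z) ^+ 8 <= 27%:R * (5%:R * n.+1%:R).
  by apply: ler_pM => //; [exact: flat_ge0|rewrite exprn_ge0 // ltW].
by move/le_trans; apply; rewrite mulrA -natrM.
Qed.

Lemma smooth_bounded v : smooth v -> exists2 M, 0 <= M & forall z, disk R z -> `|v z| <= M.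
Proof.
move=> /(_ [::])[/= cv _].
have /compact_bounded[M [_ HM]] := continuous_compact (continuous_subspaceT cv) (@square_compact R).
exists (Num.max (M + 1) 0); first by rewrite le_max lexx orbT.
by move=> z /disk_square Dz; rewrite le_max HM ?ltrDl //; exists z.
Qed.

End Cutoff.

(** * The weak solution *)

Section Existence.
Context {R : realType}.
Local Notation Rm := (measurableTypeR R).
Local Notation R2 := (measurableTypeR R * measurableTypeR R)%type.
Local Notation D := (disk R : set R2).
Implicit Types (s e : R) (z : R * R) (i : bool) (f g u v : R * R -> R).

Lemma sm_thz : smooth_on (disk R) (@thz R).
Proof.
apply: sm_atan; apply: sm_mul; first by apply: sm_mul; [exact: sm_cst|exact: sm_snd].
apply: sm_inv; last exact: sm_dsk.
by move=> z Dz; rewrite gt_eqF // dsk_gt0.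
Qed.

(** The square root of pi + theta, which stays between pi/2 and 3 pi/2: the shift by pi keeps it
    away from 0. Being affine in theta, its square has a constant theta-derivative, and the Jacobian
    becomes a function of t times [gt2]. *)
Definition qz z : R := expR (ln (pi + thz z) / 2%:R).

Lemma thz_gt0 z : 0 < pi + thz z.
Proof. by have := atan_gtNpi2 (2%:R * z.2 / dsk z); have := @pi_gt0 R; rewrite /thz; lra. Qed.

Lemma qz_sqr z : qz z ^+ 2 = pi + thz z.
Proof. by rewrite /qz -expRM_natl mulrC divfK ?pnatr_eq0 // lnK // posrE thz_gt0. Qed.

Lemma qz_bounds z : 1 <= qz z ^+ 2 <= 6%:R.
Proof.
rewrite qz_sqr /thz; have := atan_gtNpi2 (2%:R * z.2 / dsk z).
have := atan_ltpi2 (2%:R * z.2 / dsk z); have := @pihalf_lt2 R; have := @pihalf_ge1 R.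
by move=> ? ? ? ?; apply/andP; split; lra.
Qed.

Lemma qz_gt0 z : 0 < qz z. Proof. exact: expR_gt0. Qed.

Lemma sm_qz : smooth_on (disk R) qz.
Proof.
apply: sm_exp; apply: sm_mul; last exact: sm_cst.
apply: sm_ln; first by move=> z _; exact: thz_gt0.
by apply: sm_add; [exact: sm_cst|exact: sm_thz].
Qed.

Lemma is_derive_qz i z : disk R z -> is_derive z (dir i) qz (thgrad i z / (2%:R * qz z)).
Proof.
move=> Dz; have D1 := is_derive_add (is_derive_cst (pi : R) z (dir i)) (is_derive_thz i Dz).
have D2 := @is_derive_comp R _ (@ln R) (fun z => pi + thz z) z _ _ _ (is_derive1_ln (thz_gt0 z)) D1.
apply: is_derive_val (is_derive_comp (is_derive_expR _) (is_derive_mul D2 (is_derive_cst (2%:R^-1 : R) _ _))) _.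
rewrite /cst -/(qz z) -qz_sqr; have q0 : qz z != 0 by rewrite gt_eqF // qz_gt0.
by field.
Qed.

Lemma sm_invWt_tz k : smooth_on (disk R) (fun z => (Wt (tz z) ^+ k)^-1).
Proof. by apply: sm_invWt; exact: sm_tz. Qed.

Lemma sm_Wt_tz k : smooth_on (disk R) (fun z => Wt (tz z) ^+ k).
Proof. by apply/sm_pow/sm_Wt; exact: sm_tz. Qed.

Lemma sm_psit : smooth_on (disk R) (fun z => psit (tz z)).
Proof.
apply: sm_sub; first exact: sm_Wt_tz.
by apply: sm_mul; [exact: sm_cst|exact: sm_invWt_tz].
Qed.

Lemma sm_tz2 : smooth_on (disk R) (fun z => tz z ^+ 2).
Proof. by apply: sm_pow; exact: sm_tz. Qed.

Lemma sm_dpsit : smooth_on (disk R) (fun z => dpsit (tz z)).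
Proof.
apply: sm_mul; last exact: sm_invWt_tz.
apply: sm_mul; first exact: sm_tz.
by apply: sm_add; [exact: sm_tz2|exact: sm_cst].
Qed.

Lemma sm_Et : smooth_on (disk R) (fun z => Et (tz z)).
Proof. by apply: sm_mul; [apply: sm_sin; exact: sm_psit|exact: sm_invWt_tz]. Qed.

Lemma sm_Ft : smooth_on (disk R) (fun z => Ft (tz z)).
Proof. by apply: sm_mul; [apply: sm_cos; exact: sm_psit|exact: sm_invWt_tz]. Qed.

Lemma sm_inv8Wt k : smooth_on (disk R) (fun z => (8%:R * Wt (tz z) ^+ k)^-1).
Proof.
apply: sm_inv; first by move=> z _; rewrite mulf_neq0 ?expf_neq0 ?Wt_neq0 ?pnatr_eq0.
by apply: sm_mul; [exact: sm_cst|exact: sm_Wt_tz].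
Qed.

Lemma sm_dEt : smooth_on (disk R) (fun z => dEt (tz z)).
Proof.
apply: sm_sub; (apply: sm_mul; last by [exact: sm_invWt_tz|exact: sm_inv8Wt]).
  by apply: sm_mul; [apply: sm_cos; exact: sm_psit|exact: sm_dpsit].
apply: sm_mul; last exact: sm_tz.
by apply: sm_mul; [exact: sm_cst|apply: sm_sin; exact: sm_psit].
Qed.

Lemma sm_dFt : smooth_on (disk R) (fun z => dFt (tz z)).
Proof.
apply: sm_sub; (apply: sm_mul; last by [exact: sm_invWt_tz|exact: sm_inv8Wt]).
  by apply: sm_mul; [apply/sm_opp/sm_sin; exact: sm_psit|exact: sm_dpsit].
apply: sm_mul; last exact: sm_tz.
by apply: sm_mul; [exact: sm_cst|apply: sm_cos; exact: sm_psit].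
Qed.

Lemma sm_tgrad i : smooth_on (disk R) (tgrad i).
Proof.
case: i; (apply: sm_mul; last exact: sm_invAB).
  apply: sm_opp; apply: sm_mul; last exact: sm_snd.
  by apply: sm_mul; [exact: sm_cst|exact: sm_fst].
apply: sm_mul; first exact: sm_cst.
apply: sm_add; last by apply: sm_pow; exact: sm_snd.
by apply: sm_sub; [exact: sm_cst|apply: sm_pow; exact: sm_fst].
Qed.

Lemma sm_thgrad i : smooth_on (disk R) (thgrad i).
Proof. by case: i; [exact: (sm_tgrad false)|apply: sm_opp; exact: (sm_tgrad true)]. Qed.

Section Pair.
Variables (E dE : R -> R).
Hypothesis dEE : forall s, is_derive s (1 : R) E (dE s).
Hypothesis sE : smooth_on (disk R) (fun z => E (tz z)).
Hypothesis sdE : smooth_on (disk R) (fun z => dE (tz z)).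
Hypothesis E_le : forall s, E s ^+ 2 <= 1 / Wt s ^+ 10.
Hypothesis dE_le : forall s, dE s ^+ 2 <= 25%:R / Wt s ^+ 10.

(** The common form of a and b, which differ only by the profile E, equal to [Et] or to [Ft]. *)
Definition pairf z : R := qz z * E (tz z).
Definition pairg i z : R :=
  qz z * dE (tz z) * tgrad i z + E (tz z) * thgrad i z / (2%:R * qz z).

Lemma sm_pairf : smooth_on (disk R) pairf.
Proof. by apply: sm_mul => //; exact: sm_qz. Qed.

Lemma sm_pairg i : smooth_on (disk R) (pairg i).
Proof.
apply: sm_add.
  apply: sm_mul; last exact: sm_tgrad.
  by apply: sm_mul => //; exact: sm_qz.
apply: sm_mul; first by apply: sm_mul => //; exact: sm_thgrad.
apply: sm_inv; first by move=> z _; rewrite mulf_neq0 ?pnatr_eq0 // gt_eqF // qz_gt0.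
by apply: sm_mul; [exact: sm_cst|exact: sm_qz].
Qed.

Lemma is_derive_pairf i z : disk R z -> is_derive z (dir i) pairf (pairg i z).
Proof.
move=> Dz; apply: is_derive_val (is_derive_mul (is_derive_qz i Dz)
  (is_derive_comp (dEE _) (is_derive_tz i Dz))) _.
by rewrite /pairg; ring.
Qed.

Lemma pairf_bound z : `|pairf z| <= 3%:R.
Proof.
have /andP[q1 q6] := qz_bounds z.
have E1 : E (tz z) ^+ 2 <= 1.
  by apply: le_trans (E_le _) _; rewrite mul1r invWt_le1.
suff : `|pairf z| ^+ 2 <= 3%:R ^+ 2 by rewrite ler_pXn2r // nnegrE.
rewrite real_normK ?num_real // /pairf exprMn.
have : qz z ^+ 2 * E (tz z) ^+ 2 <= 6%:R * 1 by apply: ler_pM => //; exact: sqr_ge0.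
by move/le_trans; apply; rewrite mulr1 -natrX ler_nat.
Qed.

(** The gradients of t and theta are orthogonal and of equal length, so the cross terms cancel. The
    constant is 6 * 25 + 1. *)
Lemma pairg_sqr z : disk R z -> pairg false z ^+ 2 + pairg true z ^+ 2 <= 151%:R * wgt z.
Proof.
move=> Dz; have /andP[q1 q6] := qz_bounds z; have q0 := qz_gt0 z.
have -> : pairg false z ^+ 2 + pairg true z ^+ 2 =
   (qz z ^+ 2 * dE (tz z) ^+ 2 + E (tz z) ^+ 2 / (4%:R * qz z ^+ 2)) * gt2 z.
  rewrite -gt2E // /pairg /tgrad /thgrad.
  by field; rewrite gt_eqF.
rewrite /wgt [leRHS]mulrA.
  apply: ler_wpM2r.
  by rewrite -gt2E // addr_ge0 // sqr_ge0.
have W0 : 0 <= (Wt (tz z) ^+ 10)^-1 by rewrite invr_ge0 exprn_ge0 // ltW // Wt_gt0.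
have H1 : qz z ^+ 2 * dE (tz z) ^+ 2 <= 6%:R * (25%:R / Wt (tz z) ^+ 10).
  by apply: ler_pM => //; exact: sqr_ge0.
have H2 : E (tz z) ^+ 2 / (4%:R * qz z ^+ 2) <= 1 / Wt (tz z) ^+ 10 * 1.
  apply: ler_pM => //; first exact: sqr_ge0.
    by rewrite invr_ge0 mulr_ge0 // sqr_ge0.
  rewrite invf_le1; last by rewrite mulr_gt0 // (lt_le_trans _ q1).
  lra.
lra.
Qed.

Lemma pair_sobolev : Lp (disk R) +oo%E pairf /\
  sobolev_grad (disk R) 2%:E pairf (fun z => (pairg false z, pairg true z)).
Proof.
have mf : measurable_fun D pairf by apply: sm_measurable; [exact: disk_open|exact: sm_pairf].
have L2g i : Lp (disk R) 2%:E (pairg i).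
  have sg := sm_pairg i; apply: sqr_integrable_Lp2.
    by apply: sm_measurable => //; exact: disk_open.
  apply: (@sm_integrable _ _ 151%:R wgt); [exact: sm_pow|exact: wgt_integrable|].
  move=> z Dz; rewrite ger0_norm ?sqr_ge0 //; apply: le_trans (pairg_sqr Dz).
  by case: i sg => _; rewrite ?lerDl ?lerDr sqr_ge0.
split; first by apply: (@bounded_Lpy _ _ 3%:R) => // z _; exact: pairf_bound.
split.
- apply: sqr_integrable_Lp2 => //; apply: measurable_bounded_integrable.
  + exact: disk_measurable.
  + exact: disk_lty.
  + by apply: sm_measurable; [exact: disk_open|apply: sm_pow; exact: sm_pairf].
  + exists (3%:R ^+ 2); split; rewrite ?num_real // => M M1 z _ /=.
    by rewrite normrX (le_trans _ (ltW M1)) // lerXn2r ?nnegrE // pairf_bound.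
- exact: L2g.
- exact: L2g.
- apply: weak_partial_sm; [exact: sm_pairg|exact: sm_pairf|exact: is_derive_pairf].
- apply: weak_partial_sm; [exact: sm_pairg|exact: sm_pairf|exact: is_derive_pairf].
Qed.

End Pair.

(** * The right-hand side, the flux and the weak equation *)

Definition fz z : R := - dPt (tz z) * gt2 z.

(** The factors q and 1/(2q) combine to 1/2, the Jacobian of (t, theta) is [gt2], and the remaining
    factor is the [wronskian]. *)
Lemma jacobianE z : disk R z ->
  dot (pairg Et dEt false z, pairg Et dEt true z)
      (perp (pairg Ft dFt false z, pairg Ft dFt true z)) = fz z.
Proof.
move=> Dz; rewrite /dot /perp /= /pairg /tgrad /thgrad /fz -gt2E //.
have q0 : qz z != 0 by rewrite gt_eqF // qz_gt0.
transitivity (2%:R^-1 * (dEt (tz z) * Ft (tz z) - Et (tz z) * dFt (tz z)) * (tx z ^+ 2 + ty z ^+ 2)).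
  by field.
by rewrite wronskian; field.
Qed.

Lemma sm_Pt : smooth_on (disk R) (fun z => Pt (tz z)).
Proof.
apply: sm_mul; last exact: sm_invWt_tz.
apply: sm_add; first exact: sm_cst.
by apply: sm_mul; [exact: sm_cst|exact: sm_tz2].
Qed.

Lemma sm_dPt : smooth_on (disk R) (fun z => dPt (tz z)).
Proof.
apply: sm_opp; apply: sm_mul.
  apply: sm_mul; first exact: sm_tz.
  by apply: sm_add; [exact: sm_tz2|exact: sm_cst].
apply: sm_inv; first by move=> z _; rewrite mulf_neq0 ?expf_neq0 ?Wt_neq0 ?pnatr_eq0.
by apply: sm_mul; [exact: sm_cst|exact: sm_Wt_tz].
Qed.

Lemma sm_fz : smooth_on (disk R) fz.
Proof. by apply: sm_mul; [apply: sm_opp; exact: sm_dPt|exact: sm_gt2]. Qed.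

Lemma fz_bound z : disk R z -> `|fz z| <= 2%:R * wgt z.
Proof.
move=> Dz; have g0 : 0 <= gt2 z by rewrite -gt2E // addr_ge0 // sqr_ge0.
rewrite normrM normrN (ger0_norm g0) /wgt [leRHS]mulrA.
  apply: ler_wpM2r => //.
exact: dPt_le.
Qed.

(** The gradient of phi = [Phit] o t. *)
Definition Gz i z : R := Pt (tz z) * tgrad i z.
Definition dGz i z : R := Pt (tz z) * (if i then - lap_tx z else lap_tx z)
  + tgrad i z * (dPt (tz z) * tgrad i z).

Lemma sm_Gz i : smooth_on (disk R) (Gz i).
Proof. by apply: sm_mul; [exact: sm_Pt|exact: sm_tgrad]. Qed.

Lemma sm_lap_tx : smooth_on (disk R) (@lap_tx R).
Proof.
have s2 : smooth_on (disk R) (fun z => ((sA z * sB z) ^+ 2)^-1).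
  rewrite (_ : (fun z => _) = (fun z => ((sA z * sB z)^-1) ^+ 2)).
    by apply: sm_pow; exact: sm_invAB.
  by apply/funext => z; rewrite exprVn.
have s1 : smooth_on (disk R) (fun z => 4%:R * z.1) by apply: sm_mul; [exact: sm_cst|exact: sm_fst].
apply: sm_sub; first by apply: sm_mul; [exact: sm_opp|exact: sm_invAB].
apply: sm_mul => //; apply: sm_mul; last by apply: sm_opp; apply: sm_mul => //; exact: sm_dsk.
apply: sm_mul; first exact: sm_cst.
apply: sm_add; last by apply: sm_pow; exact: sm_snd.
by apply: sm_sub; [exact: sm_cst|apply: sm_pow; exact: sm_fst].
Qed.

Lemma sm_dGz i : smooth_on (disk R) (dGz i).
Proof.
apply: sm_add; apply: sm_mul.
- exact: sm_Pt.
- by case: i; [apply: sm_opp|]; exact: sm_lap_tx.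
- exact: sm_tgrad.
- by apply: sm_mul; [exact: sm_dPt|exact: sm_tgrad].
Qed.

Lemma is_derive_Gz i z : disk R z -> is_derive z (dir i) (Gz i) (dGz i z).
Proof.
move=> Dz; have D1 := is_derive_comp (is_derive_Pt _) (is_derive_tz i Dz).
have D2 : is_derive z (dir i) (tgrad i) (if i then - lap_tx z else lap_tx z).
  by case: (i); [exact: is_derive_tyy|exact: is_derive_txx].
exact: (is_derive_mul D1 D2).
Qed.

(** Harmonicity of t cancels the terms in [lap_tx], leaving phi''(t) |grad t|^2. *)
Lemma divG z : disk R z -> dGz false z + dGz true z = - fz z.
Proof. by move=> Dz; rewrite /dGz /fz -gt2E //=; ring. Qed.

Lemma Gz_bound i z : disk R z -> `|Gz i z| <= 24%:R * wgt z.
Proof.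
move=> Dz; have P3 : Pt (tz z) <= 3%:R.
  apply: le_trans (Pt_le _) _; rewrite -[leRHS]mulr1; apply: ler_wpM2l => //; exact: invWt_le1.
have T : `|tgrad i z| <= 8%:R * wgt z.
  apply: le_wgt => //; rewrite real_normK ?num_real // -gt2E //.
  by case: i; rewrite /tgrad ?lerDl ?lerDr sqr_ge0.
rewrite normrM (ger0_norm (Pt_ge0 _)).
have : Pt (tz z) * `|tgrad i z| <= 3%:R * (8%:R * wgt z) by apply: ler_pM => //; exact: Pt_ge0.
lra.
Qed.

(* The gradient of t is tangential on the unit circle. *)
Lemma radial_tz z : disk R z -> z.1 * tx z + z.2 * ty z = 2%:R^-1 * z.1 * dsk z * gt2 z.
Proof.
move=> Dz; have A0 := gt_eqF (sA_gt0 Dz); have B0 := gt_eqF (sB_gt0 Dz).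
by rewrite /tx /ty /gt2 /dsk; field; rewrite A0 B0.
Qed.

(** Integration by parts against [zeta n] times v gives the desired identity weighted by [zeta n],
    plus the flux of [Gz] along the gradient of [zeta n]. That gradient is radial with a factor
    1/dsk, which [radial_tz] cancels; this is where the Neumann condition enters. What is left is
    bounded by a multiple of [Pt] times [gt2], not integrable by itself, and the gain [Wt]^(-8) of
    [dzeta_bound] brings it down to [wgt]. *)
Lemma neumann_weak v : smooth v ->
  \int[lebesgue2]_(z in D) (Gz false z * partial false v z + Gz true z * partial true v z) =
  \int[lebesgue2]_(z in D) (fz z * v z).
Proof.
move=> sv; have sv' i : smooth (partial i v).
  by move=> s; have := sv (rcons s i); rewrite foldr_rcons.
have dv i z : is_derive z (dir i) v (partial i v z).
  by apply: derivableP; have [_] := sv [::]; exact.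
pose lhs z := Gz false z * partial false v z + Gz true z * partial true v z.
have slhs : smooth_on (disk R) lhs.
  by apply: sm_add; apply: sm_mul; try exact: sm_Gz; exact: sm_smooth.
have srhs : smooth_on (disk R) (fun z => fz z * v z).
  by apply: sm_mul; [exact: sm_fz|exact: sm_smooth].
have [M M0 vM] := smooth_bounded sv.
have [M1 M10 vM1] := smooth_bounded (sv' false).
have [M2 M20 vM2] := smooth_bounded (sv' true).
have lhs_b z : disk R z -> `|lhs z| <= (24%:R * (M1 + M2)) * wgt z.
  move=> Dz; apply: le_trans (ler_normD _ _) _; rewrite (normrM (Gz false z)) (normrM (Gz true z)).
  have : `|Gz false z| * `|partial false v z| <= (24%:R * wgt z) * M1.
    by apply: ler_pM => //; [exact: Gz_bound|exact: vM1].
  have : `|Gz true z| * `|partial true v z| <= (24%:R * wgt z) * M2.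
    by apply: ler_pM => //; [exact: Gz_bound|exact: vM2].
  lra.
have rhs_b z : disk R z -> `|fz z * v z| <= (2%:R * M) * wgt z.
  move=> Dz; rewrite normrM.
  have : `|fz z| * `|v z| <= (2%:R * wgt z) * M.
    by apply: ler_pM => //; [exact: fz_bound|exact: vM].
  lra.
have Ilhs := sm_integrable slhs wgt_integrable lhs_b.
have Irhs := sm_integrable srhs wgt_integrable rhs_b.
pose dz n z := flat 2 (1 + ln (dsk z) / n.+1%:R) / n.+1%:R.
pose J n z := zeta n z * (lhs z - fz z * v z) - dz n z * (z.1 * (Pt (tz z) * gt2 z) * v z).
have sJ n : smooth_on (disk R) (J n).
  apply: sm_sub; first by apply: sm_mul; [exact: sm_zeta|exact: sm_sub].
  apply: sm_mul.
    apply: sm_mul; last exact: sm_cst.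
    apply: sm_flat; apply: sm_add; first exact: sm_cst.
    apply: sm_mul; last exact: sm_cst.
    by apply: sm_ln; [exact: dsk_gt0|exact: sm_dsk].
  apply: sm_mul; last exact: sm_smooth.
  by apply: sm_mul; [exact: sm_fst|apply: sm_mul; [exact: sm_Pt|exact: sm_gt2]].
have J0 n : \int[lebesgue2]_(z in D) J n z = 0.
  set h := (fun z => zeta n z * v z) \_ (disk R).
  have th : test_function (disk R) h by apply: test_zeta; exact: sm_smooth.
  have dh i z : disk R z -> partial i h z = zeta n z * partial i v z + v z *
      (dz n z * (- (2%:R * (if i then z.2 else z.1)) / dsk z)).
    move=> Dz; apply: partialE; apply: (@near_eq_is_derive R _ R (fun z => zeta n z * v z)).
      near=> y; rewrite /h patchE mem_set //; near: y; apply: open_nbhs_nbhs.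
      by split => //; exact: disk_open.
    exact: is_derive_mul (is_derive_zeta n i Dz) (dv i z).
  have I i := ibp (sm_Gz i) (sm_dGz i) (is_derive_Gz i) th.
  have IG i : lebesgue2.-integrable D (EFin \o (fun z => Gz i z * partial i h z)).
    by apply: integrable_mul_test; [exact: sm_Gz|exact: test_partial].
  have IdG i : lebesgue2.-integrable D (EFin \o (fun z => dGz i z * h z)).
    by apply: integrable_mul_test; [exact: sm_dGz|].
  (* [J n] is rewritten as the sum over both directions of the two sides of [ibp], which then
     cancel; the divergence terms reproduce -f through [divG]. *)
  transitivity (\int[lebesgue2]_(z in D) ((Gz false z * partial false h z + Gz true z * partial true h z)
      + (dGz false z * h z + dGz true z * h z))).
    apply: eq_Rintegral => z /set_mem Dz; rewrite !dh //.
    have -> : h z = zeta n z * v z by rewrite /h patchE mem_set.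
    have d0 : dsk z != 0 by rewrite gt_eqF // dsk_gt0.
    rewrite -[in RHS]mulrDl divG // /J /lhs.
    have -> : z.1 * (Pt (tz z) * gt2 z) = 2%:R * (z.1 * Gz false z + z.2 * Gz true z) / dsk z.
      transitivity (2%:R * Pt (tz z) * (z.1 * tx z + z.2 * ty z) / dsk z); last by rewrite /Gz /=; ring.
      by rewrite radial_tz //; field.
    by field.
  rewrite RintegralD; [|exact: disk_measurable|exact: (integrableD disk_measurable (IG false) (IG true))
    |exact: (integrableD disk_measurable (IdG false) (IdG true))].
  rewrite RintegralD; [|exact: disk_measurable|exact: IG|exact: IG].
  rewrite RintegralD; [|exact: disk_measurable|exact: IdG|exact: IdG].
  by rewrite !I addrACA !addNr addr0.
have L0 : \int[lebesgue2]_(z in D) (flat 0 1 * (lhs z - fz z * v z)) = 0.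
  apply: (@dct_zero _ J _ (fun z => (24%:R * (M1 + M2) + 2%:R * M + 405%:R * M) * wgt z)).
  - by move=> n; apply: sm_measurable; [exact: disk_open|].
  - apply: sm_measurable; first exact: disk_open.
    by apply: sm_mul; [exact: sm_cst|exact: sm_sub].
  - move=> z Dz; rewrite -[X in _ --> X]subr0; apply: cvgB.
      by apply: cvgM; [exact: zeta_cvg|exact: cvg_cst].
    rewrite -[X in _ --> X](mul0r (z.1 * (Pt (tz z) * gt2 z) * v z)).
    by apply: cvgM; [exact: dzeta_cvg|exact: cvg_cst].
  - move=> n z Dz; have w0 := wgt_ge0 Dz; rewrite /J.
    have /andP[z0 z1] := zeta_bound n z.
    have g0 : 0 <= gt2 z by rewrite -gt2E // addr_ge0 // sqr_ge0.
    have B1 : `|zeta n z * (lhs z - fz z * v z)| <= (24%:R * (M1 + M2)) * wgt z + (2%:R * M) * wgt z.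
      rewrite normrM (ger0_norm z0) -[leRHS]mul1r; apply: ler_pM => //.
      by apply: le_trans (ler_normB _ _) _; apply: lerD; [exact: lhs_b|exact: rhs_b].
    have /andP[d0 d1] := dzeta_bound n Dz.
    (* The exponents add up as 8 + 2 = 10, and 405 = 135 * 3. *)
    have B2 : `|dz n z * (z.1 * (Pt (tz z) * gt2 z) * v z)| <= (405%:R * M) * wgt z.
      rewrite normrM (ger0_norm d0) normrM (normrM z.1) (normrM (Pt (tz z))) (ger0_norm (Pt_ge0 _)) (ger0_norm g0).
      have x1 : `|z.1| <= 1.
        by have [+ _] := disk_square Dz; rewrite /= in_itv /= ler_norml.
      have H : `|z.1| * (Pt (tz z) * gt2 z) * `|v z| <= 1 * (3%:R / Wt (tz z) ^+ 2 * gt2 z) * M.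
        apply: ler_pM => //; last exact: vM.
          by rewrite mulr_ge0 // mulr_ge0 // Pt_ge0.
        apply: ler_pM => //; first by rewrite mulr_ge0 // Pt_ge0.
        by apply: ler_wpM2r => //; exact: Pt_le.
      apply: (@le_trans _ _ (135%:R / Wt (tz z) ^+ 8 * (1 * (3%:R / Wt (tz z) ^+ 2 * gt2 z) * M))).
        apply: ler_pM; [exact: d0| |exact: d1|exact: H].
        by rewrite mulr_ge0 // mulr_ge0 // mulr_ge0 // Pt_ge0.
      rewrite le_eqVlt; apply/orP; left; apply/eqP; rewrite /wgt.
      by field; rewrite Wt_neq0.
    by apply: le_trans (ler_normB _ _) _; lra.
  - have := integrableZl disk_measurable (24%:R * (M1 + M2) + 2%:R * M + 405%:R * M) (@wgt_integrable R).
    exact.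
  - exact: J0.
have Isub := integrableB disk_measurable Ilhs Irhs.
move: L0; rewrite RintegralZl; [|exact: disk_measurable|exact: Isub].
(* The cut-offs converge to the nonzero constant [flat 0 1], which is divided out. *)
move/eqP; rewrite mulf_eq0 gt_eqF ?flat01_gt0 //= => /eqP.
rewrite RintegralB; [|exact: disk_measurable|exact: Ilhs|exact: Irhs].
by move/eqP; rewrite subr_eq0 => /eqP.
Unshelve. all: by end_near. Qed.

Lemma disk_measure_gt0 : 0 < fine (lebesgue2 D).
Proof.
apply: fine_gt0; rewrite disk_lty andbT.
pose I := (`[0, 2^-1]%classic : set Rm).
have mI : measurable I by exact: measurable_itv.
have LI : lebesgue_measure I = (2^-1)%:E.
  by rewrite /I lebesgue_measure_itv /= lte_fin invr_gt0 ltr0n -EFinB subr0.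
apply: (@lt_le_trans _ _ (lebesgue2 (I `*` I))).
  rewrite /lebesgue2 product_measure1E //.
  set L := lebesgue_measure _ in LI; change (0 < L * L)%E.
  by rewrite LI -EFinM lte_fin mulr_gt0.
apply: le_measure; rewrite ?inE; [exact: measurableX|exact: disk_measurable|].
move=> z [/=]; rewrite /I /= !in_itv /= /disk /= => /andP[? ?] /andP[? ?]; nra.
Qed.

Lemma exists_solution : exists phi, neumann_solution fz phi.
Proof.
pose F z := Phit (tz z); pose c := (\int[lebesgue2]_(z in D) F z) / fine (lebesgue2 D).
have sF : smooth_on (disk R) F.
  apply: sm_mul; last exact: sm_invWt_tz.
  by apply: sm_mul; [exact: sm_cst|exact: sm_tz].
have IF : lebesgue2.-integrable D (EFin \o F).
  (* 8/3 <= 3 and [tz_le_wgt] give 3 * 64 = 192. *)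
  apply: (@sm_integrable _ _ (192%:R) wgt) => //; first exact: wgt_integrable.
  move=> z Dz; rewrite /F /Phit normrM (normrM (8%:R / 3%:R)) (ger0_norm (_ : 0 <= (Wt (tz z) ^+ 2)^-1)); last first.
    by rewrite invr_ge0 exprn_ge0 // ltW // Wt_gt0.
  apply: (@le_trans _ _ (3%:R * `|tz z| * 1)); last by have := tz_le_wgt Dz; lra.
  apply: ler_pM; rewrite ?mulr_ge0 ?invr_ge0 ?exprn_ge0 ?(ltW (Wt_gt0 _)) //.
    by apply: ler_wpM2r => //; rewrite ger0_norm; lra.
  exact: invWt_le1.
have Ic : lebesgue2.-integrable D (EFin \o (fun=> c)).
  apply: measurable_bounded_integrable; [exact: disk_measurable|exact: disk_lty|exact: measurable_cst|].
  by exists `|c|; split; rewrite ?num_real // => M M1 z _ /=; rewrite ltW.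
exists (fun z => F z - c), (fun z => (Gz false z, Gz true z)); split.
- have IG i : Lp (disk R) 1%:E (Gz i).
    apply/Lp1P; apply: (@sm_integrable _ _ (24%:R) wgt); [exact: sm_Gz|exact: wgt_integrable|].
    by move=> z Dz; exact: Gz_bound.
  have sFc : smooth_on (disk R) (fun z => F z - c) by apply: sm_sub => //; exact: sm_cst.
  have dF i z : disk R z -> is_derive z (dir i) (fun z => F z - c) (Gz i z).
    move=> Dz; apply: is_derive_val (is_derive_add (is_derive_comp (is_derive_Phit _) (is_derive_tz i Dz)) (is_derive_cst (- c) _ _)) _.
    by rewrite addr0.
  split; [|exact: IG|exact: IG|..].
  + by apply/Lp1P; exact: (integrableB disk_measurable IF Ic).
  + by apply: weak_partial_sm => //; exact: sm_Gz.
  + by apply: weak_partial_sm => //; exact: sm_Gz.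
- rewrite RintegralB; [|exact: disk_measurable|exact: IF|exact: Ic].
  rewrite Rintegral_cst; last exact: disk_measurable.
  by rewrite /c divfK ?subrr // gt_eqF // disk_measure_gt0.
- by move=> v sv; rewrite -neumann_weak //; apply: eq_Rintegral.
Qed.

End Existence.

(** * The energy bound for a solution in H^1 *)

Section Nonexistence.
Context {R : realType}.
Local Notation Rm := (measurableTypeR R).
Local Notation R2 := (measurableTypeR R * measurableTypeR R)%type.
Local Notation D := (disk R : set R2).
Local Notation I11 := (`[(-1)%R, 1%R]%classic : set (measurableTypeR R)).
Local Notation mu := (@lebesgue_measure R).
Implicit Types (s e : R) (z : R * R) (i : bool) (f g u v : R * R -> R).

Lemma integrable_mul_bounded g f (M : R) : lebesgue2.-integrable D (EFin \o g) ->
  measurable_fun D f -> (forall z, disk R z -> `|f z| <= M) ->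
  lebesgue2.-integrable D (EFin \o (fun z => g z * f z)).
Proof.
move=> Ig mf fM.
have mg : measurable_fun D g by apply/measurable_EFinP; exact: measurable_int Ig.
have M0 : 0 <= M by apply: le_trans (fM (0, 0) _) => //; rewrite /disk /= expr0n /= addr0.
apply: (@le_integrable _ _ _ lebesgue2 _ disk_measurable _ (EFin \o (fun z => M * g z))).
- by apply/measurable_EFinP; exact: measurable_funM.
- move=> z Dz; rewrite /= lee_fin normrM normrM (ger0_norm M0) mulrC.
  by apply: ler_wpM2r => //; exact: fM.
- exact: (integrableZl disk_measurable M Ig).
Qed.

(** A weak derivative is tested on compact supports only. Inserting [zeta n] times v and letting n
    grow, dominated convergence extends the equality to v smooth up to the circle. This allows the
    L^1 gradient of a weak solution to be replaced by an L^2 gradient. *)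
Lemma weak_partial_unique i (phi g g' v : R * R -> R) :
  lebesgue2.-integrable D (EFin \o g) -> lebesgue2.-integrable D (EFin \o g') ->
  weak_partial (disk R) i phi g -> weak_partial (disk R) i phi g' -> smooth v ->
  \int[lebesgue2]_(z in D) (g z * v z) = \int[lebesgue2]_(z in D) (g' z * v z).
Proof.
move=> Ig Ig' wg wg' sv; have [M M0 vM] := smooth_bounded sv.
have mg : measurable_fun D g by apply/measurable_EFinP; exact: measurable_int Ig.
have mg' : measurable_fun D g' by apply/measurable_EFinP; exact: measurable_int Ig'.
have smv : smooth_on (disk R) v by exact: sm_smooth.
have mv : measurable_fun D v by apply: sm_measurable => //; exact: disk_open.
have mz n : measurable_fun D (@zeta R n).
  by apply: sm_measurable; [exact: disk_open|exact: sm_zeta].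
have szv n : smooth_on (disk R) (fun z => zeta n z * v z) by apply: sm_mul => //; exact: sm_zeta.
have mzv n : measurable_fun D (fun z => zeta n z * v z).
  by apply: sm_measurable => //; exact: disk_open.
have zvM n z : disk R z -> `|zeta n z * v z| <= M.
  move=> Dz; have /andP[z0 z1] := zeta_bound n z.
  by rewrite normrM (ger0_norm z0) -[leRHS]mul1r; apply: ler_pM => //; exact: vM.
have Iv := integrable_mul_bounded Ig mv vM; have Iv' := integrable_mul_bounded Ig' mv vM.
have Izv n := integrable_mul_bounded Ig (mzv n) (@zvM n).
have Izv' n := integrable_mul_bounded Ig' (mzv n) (@zvM n).
have L0 : \int[lebesgue2]_(z in D) (flat 0 1 * (g z * v z - g' z * v z)) = 0.
  apply: (@dct_zero _ (fun n z => g z * (zeta n z * v z) - g' z * (zeta n z * v z)) _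
     (fun z => M * (`|g z| + `|g' z|))).
  - by move=> n; apply: measurable_funB; exact: measurable_funM.
  - by apply: measurable_funM => //; apply: measurable_funB; exact: measurable_funM.
  - move=> z Dz; rewrite mulrBr [X in X - _]mulrCA [X in _ - X]mulrCA.
    by apply: cvgB; apply: cvgM; try exact: cvg_cst; apply: cvgM; try exact: cvg_cst; exact: zeta_cvg.
  - move=> n z Dz; apply: le_trans (ler_normB _ _) _; rewrite mulrDr.
    rewrite (normrM (g z)) (normrM (g' z)).
    by apply: lerD; rewrite mulrC; apply: ler_wpM2r => //; exact: zvM.
  - have An := integrable_abse Ig; have An' := integrable_abse Ig'.
    exact: (integrableZl disk_measurable M (integrableD disk_measurable An An')).
  - move=> n; rewrite RintegralB; [|exact: disk_measurable|exact: Izv|exact: Izv'].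
    have tz := test_zeta n smv.
    have E h : \int[lebesgue2]_(z in D) (h z * (zeta n z * v z)) =
       \int[lebesgue2]_(z in D) (h z * ((fun z => zeta n z * v z) \_ (disk R)) z).
      by apply: eq_Rintegral => z Dz; rewrite patchE Dz.
    rewrite !E; have := wg _ tz; have := wg' _ tz => -> /oppr_inj ->.
    exact: subrr.
have Isub := integrableB disk_measurable Iv Iv'.
move: L0; rewrite RintegralZl; [|exact: disk_measurable|exact: Isub].
move/eqP; rewrite mulf_eq0 gt_eqF ?flat01_gt0 //= => /eqP.
rewrite RintegralB; [|exact: disk_measurable|exact: Iv|exact: Iv'].
by move/eqP; rewrite subr_eq0 => /eqP.
Qed.

(** The fourth root of the logarithm at the singularity 1, regularized at distance sqrt e. For e > 0
    it is smooth on the whole plane, hence admissible in the weak formulation. *)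
Definition ve e z : R := r4 (ell (sig 1 z + e)).
Definition dve e i z : R := (4%:R * ve e z ^+ 3)^-1 *
  (- ((sig 1 z + e) * (sig 1 z + e + 1))^-1 * (if i then 2%:R * z.2 else - (2%:R * (1 - z.1)))).

Lemma smooth_ve e : 0 < e -> smooth (ve e).
Proof.
move=> e0; apply: sm_smoothT.
have s0 z : 0 < sig 1 z + e by rewrite ltr_wpDl ?sig_ge0.
apply: sm_r4; first by move=> z _; apply: ell_gt0; exact: ltW.
apply: sm_ell; first by move=> z _.
by apply: sm_add; [exact: sm_sig|exact: sm_cst].
Qed.

Lemma is_derive_ve e i z : 0 < e -> is_derive z (dir i) (ve e) (dve e i z).
Proof.
move=> e0; have s0 : 0 < sig 1 z + e by rewrite ltr_wpDl ?sig_ge0.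
have D0 : is_derive z (dir i) (fun z => sig 1 z + e) (if i then 2%:R * z.2 else - (2%:R * (1 - z.1))).
  have E : (fun z : R * R => sig 1 z + e) = (fun z => sB z + e).
    by apply/funext => y; rewrite /sig /sB mul1r.
  rewrite E; apply: is_derive_val (is_derive_add (is_derive_sB i z) (is_derive_cst e _ _)) _.
  by rewrite addr0.
have D1 := @is_derive_comp R _ ell (fun z => sig 1 z + e) z _ _ _ (is_derive_ell s0) D0.
exact: (@is_derive_comp R _ r4 (fun z => ell (sig 1 z + e)) z _ _ _ (is_derive_r4 (ell_gt0 (ltW s0))) D1).
Qed.

(** The exact value decays like ell^(-3/2)/(4 sigma); since ell >= 1 the exponent may be weakened to
    5/4, which brings it under [K_bound]. *)
Lemma dve_sqr e z : 0 < e -> dve e false z ^+ 2 + dve e true z ^+ 2 <= Kf 1 e z.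
Proof.
move=> e0; have s0 : 0 < sig 1 z + e by rewrite ltr_wpDl ?sig_ge0.
have v1 : 1 <= ve e z by apply/r4_ge1/ell_ge1/ltW.
have v0 : 0 < ve e z by exact: r4_gt0.
rewrite /Kf -/(ve e z); set S := sig 1 z + e in s0 *.
have P0 : 0 < 4%:R * ve e z ^+ 6 * S * (S + 1) ^+ 2.
  apply: mulr_gt0; last by apply: exprn_gt0; lra.
  by apply: mulr_gt0 => //; apply: mulr_gt0 => //; exact: exprn_gt0.
have -> : dve e false z ^+ 2 + dve e true z ^+ 2 =
    (4%:R * ve e z ^+ 6 * S * (S + 1) ^+ 2)^-1 * (sig 1 z / S).
  rewrite /dve -/S /sig mul1r; field.
  by rewrite !gt_eqF // addr_gt0.
apply: (@le_trans _ _ ((4%:R * ve e z ^+ 6 * S * (S + 1) ^+ 2)^-1 * 1)).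
  apply: ler_wpM2l; first by rewrite invr_ge0 ltW.
  by rewrite ler_pdivrMr // mul1r /S lerDl ltW.
rewrite mulr1 lef_pV2 ?posrE; last 2 first.
- exact: P0.
- by rewrite mulr_gt0 ?exprn_gt0.
have H1 : 1 <= (S + 1) ^+ 2 by apply: exprn_ege1; lra.
have H2 : ve e z ^+ 5 <= ve e z ^+ 6 by apply: ler_weXn2l.
have V5 : 0 < ve e z ^+ 5 by rewrite exprn_gt0.
have H3 : ve e z ^+ 5 * S <= ve e z ^+ 6 * S by apply: ler_wpM2r => //; exact: ltW.
have V6 : 0 <= ve e z ^+ 6 * S by rewrite ltW // mulr_gt0 ?exprn_gt0.
have : ve e z ^+ 6 * S * 1 <= ve e z ^+ 6 * S * (S + 1) ^+ 2 by apply: ler_wpM2l.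
lra.
Qed.

(** After exchanging gradients, p . d <= |p|^2 + |d|^2 bounds the pairing by the energy of phi plus
    that of [ve e], and the latter is at most 288 for every e. *)
Lemma energy_bound phi f : neumann_solution f phi -> sobolev (disk R) 2%:E phi ->
  exists C, forall e, 0 < e <= 1 -> \int[lebesgue2]_(z in D) (f z * ve e z) <= C.
Proof.
move=> [g [[_ /Lp1P Ig1 /Lp1P Ig2 wg1 wg2] _ weak]] [g' [_ L1 L2 wg1' wg2']].
have Ig1' := Lp2_Lp1 L1; have Ig2' := Lp2_Lp1 L2.
have Is1 := Lp2_sqr_integrable L1; have Is2 := Lp2_sqr_integrable L2.
pose q z := (g' z).1 ^+ 2 + (g' z).2 ^+ 2.
have Iq := integrableD disk_measurable Is1 Is2.
exists (\int[lebesgue2]_(z in D) q z + 288%:R) => e /andP[e0 e1].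
have sv := smooth_ve e0.
have sv' i : smooth (partial i (ve e)).
  by move=> s; have := sv (rcons s i); rewrite foldr_rcons.
have pv i z : partial i (ve e) z = dve e i z by apply: partialE; exact: is_derive_ve.
have Ip h i : lebesgue2.-integrable D (EFin \o h) ->
    lebesgue2.-integrable D (EFin \o (fun z => h z * partial i (ve e) z)).
  move=> Ih; have [M _ vM] := smooth_bounded (sv' i); apply: integrable_mul_bounded Ih _ vM.
  exact: (sm_measurable disk_open (sm_smooth _ (sv' i))).
have IK : lebesgue2.-integrable D (EFin \o Kf 1 e).
  apply/integrableP; split.
    apply/measurable_EFinP; apply: sm_measurable; first exact: disk_open.
    by apply: sm_Kf => [|z _]; [exact: ltW|rewrite ltr_wpDl ?sig_ge0].
  apply: le_lt_trans (ltry 288%:R); apply: le_trans (@K_bound R 1 e (or_introl erefl) ltac:(by rewrite e0 e1)).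
  by under eq_integral => z _ do rewrite /= ger0_norm ?Kf_ge0 ?(ltW e0) //.
rewrite -weak //.
have -> : \int[lebesgue2]_(z in D) dot (g z) (grad (ve e) z) =
    \int[lebesgue2]_(z in D) ((g' z).1 * partial false (ve e) z + (g' z).2 * partial true (ve e) z).
  rewrite /dot /grad /= RintegralD; [|exact: disk_measurable|exact: Ip|exact: Ip].
  rewrite [RHS]RintegralD; [|exact: disk_measurable|exact: (Ip (fun z => (g' z).1))|exact: (Ip (fun z => (g' z).2))].
  have U1 := weak_partial_unique Ig1 Ig1' wg1 wg1' (sv' false).
  have U2 := weak_partial_unique Ig2 Ig2' wg2 wg2' (sv' true).
  by congr (_ + _); [exact: U1|exact: U2].
apply: (@le_trans _ _ (\int[lebesgue2]_(z in D) (q z + Kf 1 e z))).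
  apply: le_Rintegral.
  - exact: disk_measurable.
  - exact: (integrableD disk_measurable (Ip (fun z => (g' z).1) false Ig1') (Ip (fun z => (g' z).2) true Ig2')).
  - exact: (integrableD disk_measurable Iq IK).
  - move=> z Dz; rewrite !pv; apply: le_trans (lerD (lexx (q z)) (dve_sqr z e0)).
    rewrite /q; move: (g' z).1 (g' z).2 (dve e false z) (dve e true z) => p1 p2 d1 d2.
    have := sqr_ge0 (p1 - d1); have := sqr_ge0 (p2 - d2).
    have := sqr_ge0 p1; have := sqr_ge0 p2; have := sqr_ge0 d1; have := sqr_ge0 d2.
    rewrite !sqrrB; lra.
rewrite RintegralD; [|exact: disk_measurable|exact: Iq|exact: IK].
rewrite lerD2l -[leRHS]/(fine (288%:R)%:E) /Rintegral fine_le //.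
- exact: (integrable_fin_num disk_measurable IK).
- by apply: K_bound; [left|rewrite e0 e1].
Qed.

End Nonexistence.

(** * Blow-up of the right-hand side *)

Section Blowup.
Context {R : realType}.
Local Notation Rm := (measurableTypeR R).
Local Notation R2 := (measurableTypeR R * measurableTypeR R)%type.
Local Notation D := (disk R : set R2).
Local Notation I11 := (`[(-1)%R, 1%R]%classic : set (measurableTypeR R)).
Local Notation mu := (@lebesgue_measure R).
Implicit Types (s e : R) (z : R * R) (i : bool) (f g u v : R * R -> R).

Definition lamb (x : R) : R := ell (x ^+ 2).
(** The model 1/(sigma ell(sigma)) of f v at sigma = x^2. The harmless factor x^2 + 1 makes 2 x
    kap(x) exactly minus the derivative of ln lamb(x). *)
Definition kap (x : R) : R := (x ^+ 2 * (x ^+ 2 + 1) * lamb x)^-1.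

(** A truncated cone at the singularity 1, inside which [sig 1 z] lies between (1-x)^2 and 2
    (1-x)^2, x being the first coordinate. *)
Definition sector (d : R) : set (R * R) :=
  [set z | 2^-1 <= z.1 <= 1 - d /\ `|z.2| <= 1 - z.1].

Lemma lamb_gt0 x : 0 < lamb x.
Proof. by apply: ell_gt0; exact: sqr_ge0. Qed.

Lemma kap_gt0 x : 0 < x -> 0 < kap x.
Proof.
move=> x0; rewrite invr_gt0; apply: mulr_gt0; last exact: lamb_gt0.
by apply: mulr_gt0; [exact: exprn_gt0|rewrite addr_gt0 // exprn_gt0].
Qed.

Lemma sector_disk d : 0 < d -> sector d `<=` disk R.
Proof.
move=> d0 [x y] [/= /andP[x1 x2]]; rewrite ler_norml => /andP[y1 y2]; rewrite /disk /=; nra.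
Qed.

Lemma sector_closed d : closed (sector d).
Proof.
have cont (f : R * R -> R) : smooth_on setT f -> forall z, {for z, continuous f}.
  by move=> sf z; exact: (sm_continuous sf).
have cl f : smooth_on setT f -> closed [set z : R * R | 0 <= f z].
  move=> sf; apply: (@closed_comp _ _ f [set x | 0 <= x]); last exact: closed_ge.
  by move=> z _; exact: cont.
have sc c : smooth_on setT (fun _ : R * R => c) by exact: sm_cst.
have s1 := @sm_fst R setT; have s2 := @sm_snd R setT.
rewrite (_ : sector d = [set z | 0 <= z.1 - 2^-1] `&` [set z | 0 <= 1 - d - z.1] `&`
   ([set z | 0 <= 1 - z.1 - z.2] `&` [set z | 0 <= 1 - z.1 + z.2])).
  apply: closedI; apply: closedI; apply: cl.
  - exact: sm_sub.
  - exact: sm_sub.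
  - by apply: sm_sub => //; exact: sm_sub.
  - by apply: sm_add => //; exact: sm_sub.
apply/seteqP; split => [z [/andP[x1 x2]]|z [[/= x1 x2] [y1 y2]]].
  by rewrite ler_norml => /andP[y1 y2]; split; split => /=; lra.
by split; [apply/andP; split; lra|rewrite ler_norml; apply/andP; split; lra].
Qed.

Lemma sector_measurable d : measurable (sector d : set R2).
Proof.
rewrite -[sector d]setCK; apply: measurableC.
by apply: open_measurable2; apply: closed_openC; exact: sector_closed.
Qed.

Lemma sm_lamb (Om : set (R * R)) f : (forall z, Om z -> 0 < f z) -> smooth_on Om f -> smooth_on Om (fun z => lamb (f z)).
Proof.
by move=> f0 sf; apply: sm_ell; [move=> z /f0; exact: exprn_gt0|exact: sm_pow].
Qed.

Lemma sm_kap (Om : set (R * R)) f : (forall z, Om z -> 0 < f z) -> smooth_on Om f -> smooth_on Om (fun z => kap (f z)).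
Proof.
move=> f0 sf; apply: sm_inv.
  by move=> z /f0 fz; rewrite -invr_eq0 gt_eqF // kap_gt0.
apply: sm_mul; last exact: sm_lamb.
by apply: sm_mul; [exact: sm_pow|apply: sm_add; [exact: sm_pow|exact: sm_cst]].
Qed.

Lemma sector_measurable_kap d : 0 < d -> measurable_fun (sector d : set R2) (fun z => kap (1 - z.1)).
Proof.
move=> d0; have f0 z : disk R z -> 0 < 1 - z.1.
  by rewrite /disk /= => Dz; have := sqr_ge0 z.2; nra.
have sk : smooth_on (disk R) (fun z => kap (1 - z.1)).
  by apply: sm_kap => //; apply: sm_sub; [exact: sm_cst|exact: sm_fst].
apply: measurable_funS (sm_measurable disk_open sk); first exact: disk_measurable.
exact: sector_disk.
Qed.

(** The slice at x has length 2(1-x), and 2(1-x) kap(1-x) is the derivative of ln lamb(1-x). The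
    resulting bound tends to infinity doubly logarithmically as d -> 0. *)
Lemma sector_integral d : 0 < d < 2^-1 ->
  ((ln (lamb d) - ln (lamb 2^-1))%:E <= \int[lebesgue2]_(z in (sector d : set R2)) (kap (1 - z.1))%:E)%E.
Proof.
move=> /andP[d0 d2].
pose J := (`[2^-1, 1 - d]%classic : set Rm).
have mJ : measurable J by exact: measurable_itv.
have mI : measurable I11 by exact: measurable_itv.
have JI : J `<=` I11.
  move=> x; rewrite /J /= !in_itv /= => /andP[x1 x2]; apply/andP; split; lra.
have Jx (x : R) : J x -> 2^-1 <= x <= 1 - d by rewrite /J /= in_itv.
pose G z := ((fun z => (kap (1 - z.1))%:E) \_ (sector d)) z.
have SQ : sector d `<=` square by apply: subset_trans (@disk_square R); exact: sector_disk.
have G0 z : (0 <= G z)%E.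
  rewrite /G patchE; case: ifPn => // /set_mem [/andP[x1 x2] _].
  by rewrite lee_fin ltW // kap_gt0 //; lra.
have mGT : measurable_fun (setT : set R2) G.
  apply: (measurable_restrictT _ (sector_measurable d)).1.
  by apply/measurable_EFinP; exact: sector_measurable_kap.
have mG : measurable_fun (square : set R2) G by exact: measurable_funS mGT.
have [mF E] := square_tonelli mG (fun z _ => G0 z).
pose H (x : R) : R := 2%:R * (1 - x) * kap (1 - x).
have -> : (\int[lebesgue2]_(z in (sector d : set R2)) (kap (1 - z.1))%:E = \int[lebesgue2]_(z in square) G z)%E.
  rewrite integral_mkcond [RHS]integral_mkcond; apply: eq_integral => z _.
  rewrite [RHS]patchE; case: ifPn => // nz; rewrite patchE ifF //; apply/negP => /set_mem /SQ Sz.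
  by move/negP: nz; apply; exact: mem_set.
rewrite E.
have dN (x : R) : 2^-1 <= x <= 1 - d -> is_derive x (1 : R) (fun x => ln (lamb (1 - x))) (H x).
  move=> /andP[x1 x2]; have x0 : 0 < 1 - x by lra.
  have D0 := is_derive_add (is_derive_cst (1 : R) x 1) (is_derive_opp (is_derive_id x (1 : R))).
  have D1 := is_derive_exp 2 D0.
  have D2 := @is_derive_comp R R ell (fun x => (1 - x) ^+ 2) x 1 _ _ (is_derive_ell (exprn_gt0 2 x0)) D1.
  have D3 := @is_derive_comp R R (@ln R) (fun x => lamb (1 - x)) x 1 _ _ (is_derive1_ln (lamb_gt0 _)) D2.
  apply: is_derive_val D3 _; rewrite /H /kap /=.
  have L0 : lamb (1 - x) != 0 by rewrite gt_eqF ?lamb_gt0.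
  have xn0 : 1 - x != 0 by rewrite gt_eqF.
  have xn1 : (1 - x) ^+ 2 + 1 != 0 by rewrite gt_eqF // ltr_wpDl ?sqr_ge0.
  by field; rewrite L0 xn0 xn1.
have sH : smooth_on (disk R) (fun z => H z.1).
  have f0 z : disk R z -> 0 < 1 - z.1 by rewrite /disk /= => Dz; have := sqr_ge0 z.2; nra.
  have s1 : smooth_on (disk R) (fun z => 1 - z.1) by apply: sm_sub; [exact: sm_cst|exact: sm_fst].
  apply: sm_mul; last exact: sm_kap.
  by apply: sm_mul => //; exact: sm_cst.
have cH (x : R) : 2^-1 <= x <= 1 - d -> {for x, continuous H}.
  move=> /andP[x1 x2]; have [g _ dg] := sm_partial false sH.
  have Dx : disk R (x, 0) by rewrite /disk /=; nra.
  have D1 : is_derive x (1 : R) H (g (x, 0)) := @is_derive_slice1 R (fun z => H z.1) x 0 _ (dg _ Dx).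
  exact: (@is_derive1_continuous R H x (g (x, 0)) D1).
have d1 : 2^-1 < 1 - d by lra.
have half : 1 - 2^-1 = 2^-1 :> R by field.
have := FTC2 d1 dN cH; rewrite subKr half => <-.
apply: (@le_trans _ _ (\int[mu]_(x in J) \int[mu]_(y in I11) G (x, y))%E); last first.
  by apply: ge0_subset_integral => // x _; apply: integral_ge0.
apply: ge0_le_integral => //.
- move=> x /Jx /andP[x1 x2]; rewrite lee_fin /H mulr_ge0 ?mulr_ge0 //; first by lra.
  by rewrite ltW // kap_gt0 //; lra.
- apply/measurable_EFinP; apply: subspace_continuous_measurable_fun => //.
  by apply: continuous_in_subspaceT => x /set_mem /Jx; exact: cH.
- exact: measurable_funS mF.
- move=> x /Jx /andP[x1 x2].
  pose L := (`[- (1 - x), 1 - x]%classic : set Rm).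
  have mL : measurable L by exact: measurable_itv.
  have LI : L `<=` I11.
    by move=> y; rewrite /L /= !in_itv /= => /andP[y1 y2]; apply/andP; split; lra.
  apply: (@le_trans _ _ (\int[mu]_(y in L) G (x, y))%E); last first.
    apply: ge0_subset_integral => //.
    by apply: measurable_funS (measurableT_comp mGT (pair1_measurable x)).
  rewrite (eq_integral (fun=> (kap (1 - x))%:E)); last first.
    move=> y /set_mem; rewrite /L /= in_itv /= => yL; rewrite /G patchE mem_set //.
    by split; [rewrite /= x1 x2|rewrite /= ler_norml].
  rewrite integral_cst //.
  have EL : mu L = (2%:R * (1 - x))%:E.
    rewrite /L lebesgue_measure_itv /= lte_fin ifT; last by lra.
    by rewrite -EFinB; congr (_%:E); ring.
  by rewrite [X in (_ <= _ * X)%E]EL -EFinM lee_fin /H mulrC.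
Qed.

(** With l = lamb(1-x) and r its fourth root, f is at least of order r^(-5)/xi^2 and v of order r,
    whence 1/(l xi^2). Regularizing with e = d^2 is harmless because xi >= d on the sector. The
    constant collects 256 from phi'', 2 from [gt2] and 2 from v. *)
Lemma fv_lower (d : R) z : 0 < d -> sector d z ->
  1024%:R^-1 * kap (1 - z.1) <= fz z * ve (d ^+ 2) z.
Proof.
move=> d0 Sz; have Dz := sector_disk d0 Sz; move: Sz => [/andP[x1 x2]].
have A0 := sA_gt0 Dz; have B0 := sB_gt0 Dz.
set xi := 1 - z.1 => yx; have xi0 : 0 < xi by rewrite /xi; lra.
have y2 : z.2 ^+ 2 <= xi ^+ 2.
  by rewrite -[z.2 ^+ 2]real_normK ?num_real // lerXn2r ?nnegrE // ltW.
have EB : sB z = xi ^+ 2 + z.2 ^+ 2 by [].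
have EA : sA z = (2%:R - xi) ^+ 2 + z.2 ^+ 2 by rewrite /sA /xi; ring.
have dxi : d <= xi by rewrite /xi; lra.
have xi2 : xi <= 2^-1 by rewrite /xi; lra.
have y20 := sqr_ge0 z.2.
have B1 : sB z <= 2%:R * xi ^+ 2 by rewrite EB; lra.
have A4 : sA z <= 4%:R by rewrite EA; nra.
have A9 : 9%:R / 4%:R <= sA z by rewrite EA; nra.
have B12 : sB z <= 2^-1 by nra.
have l1 : 1 <= lamb xi by apply: ell_ge1; exact: sqr_ge0.
have [l lE0] : {l | lamb xi = l} by exists (lamb xi).
rewrite lE0 in l1; have [t tE] : {t | tz z = t} by exists (tz z).
have lE : l = 1 + ln (1 + (xi ^+ 2)^-1) by rewrite -lE0.
have t3 : 3%:R^-1 <= t.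
  have : ln (sB z / sA z) <= sB z / sA z - 1 by apply: ln_le; rewrite divr_gt0.
  rewrite ln_div ?posrE // => H.
  have : sB z / sA z <= 2%:R / 9%:R by rewrite ler_pdivrMr //; lra.
  by rewrite -tE /tz; lra.
have t2l : t <= 2%:R * l.
  have H1 : - ln (sB z) <= ln (1 + (xi ^+ 2)^-1).
    have xp : 0 < xi ^+ 2 by rewrite exprn_gt0.
    have xi1 : 0 < (xi ^+ 2)^-1 by rewrite invr_gt0.
    have p1 : 0 < 1 + (xi ^+ 2)^-1 by lra.
    have B1' : (sB z)^-1 <= 1 + (xi ^+ 2)^-1.
      apply: (@le_trans _ _ (xi ^+ 2)^-1); last by lra.
      by rewrite lef_pV2 ?posrE // EB lerDl.
    have Bi : 0 < (sB z)^-1 by rewrite invr_gt0.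
    by rewrite -lnV ?posrE // ler_ln ?posrE.
  have H2 := ln_le A0;
  rewrite lE.
  have : 0 <= ln (1 + (xi ^+ 2)^-1) by rewrite ln_ge0 // lerDl invr_ge0 sqr_ge0.
  by rewrite -tE /tz; lra.
have [W WE] : {W | Wt t = W} by exists (Wt t).
have W0 : 0 < W by rewrite -WE; exact: Wt_gt0.
have W16 : W ^+ 16 = 1 + t ^+ 2 by rewrite -WE; exact: Wt16.
(* This needs 1 + t^2 <= 16 t^2, hence the lower bound 1/3 on t obtained on the sector. *)
have W8 : W ^+ 8 <= 4%:R * t.
  suff H : (W ^+ 8) ^+ 2 <= (4%:R * t) ^+ 2.
    by move: H; rewrite ler_pXn2r // nnegrE ?exprn_ge0 ?(ltW W0) //; lra.
  by rewrite -exprM W16; nra.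
have [r rE] : {r | r4 l = r} by exists (r4 l).
have r0 : 0 < r by rewrite -rE; exact: r4_gt0.
have r4E : r ^+ 4 = l by rewrite -rE r4K //; lra.
(* Eighth powers reduce this to 1 + t^2 <= 256 l^2, which follows from t <= 2l and l >= 1. *)
have W2 : W ^+ 2 <= 2%:R * r.
  suff H : (W ^+ 2) ^+ 8 <= (2%:R * r) ^+ 8.
    by move: H; rewrite ler_pXn2r // nnegrE ?exprn_ge0 ?(ltW W0) // mulr_ge0 // ltW.
  have r8 : r ^+ 8 = l ^+ 2 by rewrite -r4E -exprM.
  have p8 : (2%:R : R) ^+ 8 = 256%:R by rewrite -natrX.
  by rewrite -exprM W16 exprMn r8 p8; nra.
have W10 : W ^+ 10 <= 32%:R * r ^+ 5.
  have : (W ^+ 2) ^+ 5 <= (2%:R * r) ^+ 5.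
    by rewrite lerXn2r ?nnegrE ?exprn_ge0 ?(ltW W0) // mulr_ge0 // ltW.
  by rewrite -exprM exprMn -natrX.
have g1 : (2%:R * xi ^+ 2)^-1 <= gt2 z.
  rewrite /gt2 -[(_ * _)^-1]mul1r ler_pdivrMr; last by rewrite mulr_gt0 // exprn_gt0.
  rewrite mulrAC ler_pdivlMr ?mulr_gt0 // mul1r.
  by apply: ler_pM => //; exact: ltW.
have f1 : (256%:R * r ^+ 5)^-1 * gt2 z <= fz z.
  rewrite /fz; apply: ler_wpM2r; first by rewrite divr_ge0 // mulr_ge0 // ltW.
  rewrite /dPt opprK tE WE.
  apply: (@le_trans _ _ (t * W ^+ 16 / (2%:R * W ^+ 34))).
    have -> : t * W ^+ 16 / (2%:R * W ^+ 34) = (2%:R * W ^+ 18 / t)^-1.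
      by field; rewrite !gt_eqF //; lra.
    rewrite lef_pV2 ?posrE; last 2 first.
    - by apply: mulr_gt0; [rewrite ltr0n|exact: exprn_gt0].
    - by rewrite divr_gt0 ?mulr_gt0 ?exprn_gt0 //; lra.
    rewrite ler_pdivrMr; last by lra.
    have : W ^+ 10 * W ^+ 8 <= 32%:R * r ^+ 5 * (4%:R * t).
      by apply: ler_pM => //; rewrite exprn_ge0 // ltW.
    rewrite -exprD; have -> : (10 + 8 = 18)%N by [].
    lra.
  apply: ler_wpM2r; first by rewrite invr_ge0 mulr_ge0 // exprn_ge0 // ltW.
  apply: ler_wpM2l; first by lra.
  by rewrite W16; lra.
have v1 : r / 2%:R <= ve (d ^+ 2) z.
  have S0 : 0 < sig 1 z + d ^+ 2 by rewrite ltr_wpDl ?sig_ge0 // exprn_gt0.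
  have S3 : sig 1 z + d ^+ 2 <= 3%:R * xi ^+ 2.
    have -> : sig 1 z = sB z by rewrite /sig mul1r.
    have : d ^+ 2 <= xi ^+ 2 by rewrite lerXn2r ?nnegrE // ltW.
    lra.
  have xp : 0 < xi ^+ 2 by rewrite exprn_gt0.
  (* The factor 3 inside the logarithm is absorbed by Bernoulli: 1 + w <= (1 + w/3)^3. *)
  have L3 : l / 3%:R <= ell (3%:R * xi ^+ 2).
    have [w wE] : {w | (xi ^+ 2)^-1 = w} by exists (xi ^+ 2)^-1.
    have w0 : 0 < w by rewrite -wE invr_gt0.
    rewrite lE /ell [(3%:R * _)^-1]invfM wE.
    have : ln (1 + w) <= ln ((1 + 3%:R^-1 * w) ^+ 3).
      have p0 : 0 < 1 + 3%:R^-1 * w by rewrite addr_gt0 // mulr_gt0.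
      rewrite ler_ln ?posrE ?exprn_gt0 //; last by lra.
      rewrite !exprS expr0; nra.
    rewrite lnXn; last by rewrite addr_gt0 // mulr_gt0.
    rewrite -mulr_natl; lra.
  have : r / 2%:R <= r4 (l / 3%:R).
    suff H : (r / 2%:R) ^+ 4 <= r4 (l / 3%:R) ^+ 4.
      by move: H; rewrite ler_pXn2r // nnegrE ?divr_ge0 ?(ltW r0) ?(ltW (r4_gt0 _)).
    rewrite expr_div_n r4E r4K; last by lra.
    have -> : (2%:R : R) ^+ 4 = 16%:R by rewrite -natrX.
    lra.
  move/le_trans; apply; apply: r4_le; first by lra.
  by apply: le_trans L3 _; exact: ell_anti.
have K1 : kap xi <= (xi ^+ 2 * l)^-1.
  have xp : 0 < xi ^+ 2 by rewrite exprn_gt0.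
  have l0 : 0 < l by lra.
  rewrite /kap lE0 lef_pV2 ?posrE; last 2 first.
  - by apply: mulr_gt0 => //; apply: mulr_gt0 => //; lra.
  - exact: mulr_gt0.
  apply: ler_wpM2r; first exact: ltW.
  by rewrite -[leLHS]mulr1; apply: ler_wpM2l; [exact: ltW|lra].
have r5i : 0 <= (256%:R * r ^+ 5)^-1.
  by rewrite invr_ge0; apply: mulr_ge0; [rewrite ler0n|rewrite exprn_ge0 // ltW].
apply: (@le_trans _ _ ((256%:R * r ^+ 5)^-1 * (2%:R * xi ^+ 2)^-1 * (r / 2%:R))).
  apply: (@le_trans _ _ (1024%:R^-1 * (xi ^+ 2 * l)^-1)).
    by apply: ler_wpM2l K1; rewrite invr_ge0 ler0n.
  rewrite -r4E le_eqVlt; apply/orP; left; apply/eqP.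
  by field; rewrite !gt_eqF.
apply: ler_pM.
- by apply: mulr_ge0; [exact: r5i|rewrite invr_ge0 mulr_ge0 // sqr_ge0].
- by rewrite divr_ge0 // ltW.
- by apply: le_trans f1; exact: ler_wpM2l.
- exact: v1.
Qed.

(** On the half with x >= 0 one has t >= 0, so f >= 0. On the other half the distance to the
    singularity 1 is at least 1, so v <= 2, and |f| <= 2 wgt. *)
Lemma fv_ge (e : R) z : 0 < e -> disk R z -> - (4%:R * wgt z) <= fz z * ve e z.
Proof.
move=> e0 Dz; have A0 := sA_gt0 Dz; have B0 := sB_gt0 Dz; have w0 := wgt_ge0 Dz.
have v0 : 0 < ve e z by exact: r4_gt0.
have g0 : 0 <= gt2 z by rewrite -gt2E // addr_ge0 // sqr_ge0.
have [x0|x0] := leP 0 z.1.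
  apply: (@le_trans _ _ 0); first by lra.
  apply: mulr_ge0; last exact: ltW.
  rewrite /fz mulr_ge0 // /dPt opprK divr_ge0 //; last first.
    by rewrite mulr_ge0 // exprn_ge0 // ltW // Wt_gt0.
  apply: mulr_ge0; last by have := sqr_ge0 (tz z); lra.
  by rewrite /tz divr_ge0 // subr_ge0 ler_ln ?posrE // /sA /sB; nra.
have v2 : ve e z <= 2%:R.
  have S1 : 1 <= sig 1 z + e.
    by rewrite /sig mul1r; have := sqr_ge0 z.2; nra.
  have E2 : ell (sig 1 z + e) <= 2%:R.
    apply: le_trans (ell_anti ltr01 S1) _.
    by rewrite /ell invr1; have := @ln_le R 2%:R; lra.
  suff H : ve e z ^+ 4 <= 2%:R ^+ 4.
    by move: H; rewrite ler_pXn2r // nnegrE // ltW.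
  rewrite /ve r4K; last by apply: ell_gt0; lra.
  by apply: le_trans E2 _; rewrite -natrX ler_nat.
have := fz_bound Dz.
have : `|fz z| * ve e z <= (2%:R * wgt z) * 2%:R -> - (4%:R * wgt z) <= fz z * ve e z.
  have := ler_norm (- fz z); rewrite normrN => H.
  have : - fz z * ve e z <= `|fz z| * ve e z by apply: ler_wpM2r => //; exact: ltW.
  lra.
by move=> H F; apply: H; apply: ler_pM => //; exact: ltW.
Qed.

(** Adding the integrable function 4 wgt makes the integrand nonnegative by [fv_ge], so that
    restricting to the sector only decreases the integral. *)
Lemma unbounded (C : R) : exists2 e, 0 < e <= 1 & C < \int[lebesgue2]_(z in D) (fz z * ve e z).
Proof.
pose C1 := C + \int[lebesgue2]_(z in D) (4%:R * wgt z).
(* The bound 2 ensures d < 1/2; the other one lets K exceed ln lamb(1/2) by more than 1024 [C1],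
   where 1024 is the loss in [fv_lower]. *)
pose K := Num.max 2%:R (1024%:R * C1 + ln (lamb 2^-1) + 1).
(* Then d^(-2) = exp(exp K), so lamb d >= exp K: the doubly logarithmic divergence calls for a
   doubly exponential d. *)
pose d := expR (- (expR K / 2%:R)).
have K2 : 2%:R <= K by rewrite le_max lexx.
have eK := expR_ge1Dx K.
have d0 : 0 < d by exact: expR_gt0.
have d2 : d < 2^-1.
  rewrite /d expRN ltf_pV2 ?posrE ?expR_gt0 //.
  by apply: lt_le_trans (expR_ge1Dx _); lra.
have e0 : 0 < d ^+ 2 by rewrite exprn_gt0.
have e1 : d ^+ 2 <= 1 by rewrite exprn_ile1 // ?ltW //; lra.
exists (d ^+ 2); first by rewrite e0.
have lamK : K <= ln (lamb d).
  rewrite -[leLHS]expRK ler_ln ?posrE ?expR_gt0 ?lamb_gt0 //.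
  have dE : (d ^+ 2)^-1 = expR (expR K).
    by rewrite /d -expRM_natl -expRN mulrN opprK mulrC divfK ?pnatr_eq0.
  rewrite /lamb /ell dE -[leLHS]expRK.
  have : ln (expR (expR K)) <= ln (1 + expR (expR K)) by rewrite ler_ln ?posrE ?addr_gt0 ?expR_gt0 //; lra.
  by rewrite !expRK; lra.
have sv := smooth_ve e0.
have svD : smooth_on (disk R) (fun z => fz z * ve (d ^+ 2) z) by apply: sm_mul; [exact: sm_fz|exact: sm_smooth].
have Iw : lebesgue2.-integrable D (EFin \o (fun z => 4%:R * wgt z)).
  exact: (integrableZl disk_measurable 4%:R (@wgt_integrable R)).
have [M M0 vM] := smooth_bounded sv.
have If : lebesgue2.-integrable D (EFin \o (fun z => fz z * ve (d ^+ 2) z)).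
  apply: (@sm_integrable _ _ (2%:R * M) wgt) => //; first exact: wgt_integrable.
  move=> z Dz; rewrite normrM.
  have : `|fz z| * `|ve (d ^+ 2) z| <= (2%:R * wgt z) * M.
    by apply: ler_pM => //; [exact: fz_bound|exact: vM].
  lra.
have Isum := integrableD disk_measurable If Iw.
suff : C1 < \int[lebesgue2]_(z in D) (fz z * ve (d ^+ 2) z + 4%:R * wgt z).
  by rewrite RintegralD; [rewrite /C1 ltrD2r|exact: disk_measurable|exact: If|exact: Iw].
pose T z := fz z * ve (d ^+ 2) z + 4%:R * wgt z.
have T0 z : disk R z -> (0 <= (T z)%:E)%E.
  by move=> Dz; rewrite lee_fin /T; have := fv_ge e0 Dz; lra.
have mT : measurable_fun D (EFin \o T) by exact: measurable_int Isum.
have SD := sector_disk d0.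
have [c cE] : {c : R | 1024%:R^-1 = c} by exists (1024%:R^-1).
have c0 : 0 < c by rewrite -cE invr_gt0 ltr0n.
have mS := sector_measurable d.
rewrite -lte_fin /Rintegral fineK; last exact: (integrable_fin_num disk_measurable Isum).
apply: (@lt_le_trans _ _ (\int[lebesgue2]_(z in (sector d : set R2)) (T z)%:E)%E); last first.
  by apply: ge0_subset_integral => //; exact: disk_measurable.
apply: (@lt_le_trans _ _ (\int[lebesgue2]_(z in (sector d : set R2)) (c%:E * (kap (1 - z.1))%:E))%E); last first.
  apply: ge0_le_integral => //.
  - move=> z [/andP[x1 x2] _]; rewrite -EFinM lee_fin mulr_ge0 ?(ltW c0) // ltW // kap_gt0 //; lra.
  - apply: measurable_funeM; apply/measurable_EFinP; exact: sector_measurable_kap.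
  - by apply: measurable_funS mT => //; exact: disk_measurable.
  - move=> z Sz; rewrite -EFinM lee_fin -cE; apply: le_trans (fv_lower d0 Sz) _.
    by rewrite /T lerDl mulr_ge0 // wgt_ge0 //; exact: SD.
have k0 z : sector d z -> (0 <= (kap (1 - z.1))%:E)%E.
  by move=> [/andP[x1 x2] _]; rewrite lee_fin ltW // kap_gt0 //; lra.
have mk : measurable_fun (sector d : set R2) (fun z => (kap (1 - z.1))%:E).
  by apply/measurable_EFinP; exact: sector_measurable_kap.
rewrite (ge0_integralZl_EFin lebesgue2 mS k0 mk (ltW c0)).
have := sector_integral (introT andP (conj d0 d2)) => SI.
apply: (@lt_le_trans _ _ (c%:E * (ln (lamb d) - ln (lamb 2^-1))%:E)%E); last first.
  by apply: lee_wpmul2l => //; rewrite lee_fin ltW.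
rewrite -EFinM lte_fin mulrC -cE ltr_pdivlMr; last by rewrite ltr0n.
have : 1024%:R * C1 + ln (lamb 2^-1) + 1 <= K by rewrite le_max lexx orbT.
lra.
Qed.

Lemma no_solution_H1 f phi : (forall z, disk R z -> f z = fz z) ->
  neumann_solution f phi -> ~ sobolev (disk R) 2%:E phi.
Proof.
move=> ff N S; have [C HC] := energy_bound N S; have [e e01 He] := unbounded C.
have E : \int[lebesgue2]_(z in D) (f z * ve e z) = \int[lebesgue2]_(z in D) (fz z * ve e z).
  by apply: eq_Rintegral => z /set_mem Dz; rewrite ff.
by have := HC e e01; rewrite E leNgt He.
Qed.

End Blowup.

Theorem theorem1p2 (R : realType) :
  exists (a b : R * R -> R) (ga gb : R * R -> R * R),
    [/\ Lp (disk R) +oo%E a, Lp (disk R) +oo%E b,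
        sobolev_grad (disk R) 2%:E a ga, sobolev_grad (disk R) 2%:E b gb
      & let f := fun x => dot (ga x) (perp (gb x)) in
        (exists phi, neumann_solution f phi) /\
        (forall phi, neumann_solution f phi -> ~ sobolev (disk R) 2%:E phi)].
Proof.
have [La Sa] := pair_sobolev (@is_derive_Et R) (@sm_Et R) (@sm_dEt R) (@Et_le R) (@dEt_le R).
have [Lb Sb] := pair_sobolev (@is_derive_Ft R) (@sm_Ft R) (@sm_dFt R) (@Ft_le R) (@dFt_le R).
exists (pairf (@Et R)), (pairf (@Ft R)),
  (fun z => (pairg (@Et R) (@dEt R) false z, pairg (@Et R) (@dEt R) true z)),
  (fun z => (pairg (@Ft R) (@dFt R) false z, pairg (@Ft R) (@dFt R) true z)); split => // f.
have ff z : disk R z -> f z = fz z by move=> Dz; exact: jacobianE.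
split; last by move=> phi; exact: no_solution_H1.
have [phi [g [Sg m0 weak]]] := @exists_solution R.
exists phi, g; split => // v sv; rewrite weak //; apply: eq_Rintegral => z /set_mem Dz.
by rewrite ff.
Qed.
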